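(* Let $\varkappa=(x_1,x_2,x_3,x_4)\in\mathbb{R}^{8}$ be a $D_2$-symmetric configuration of four distinct points, so that $X=\{x_1,\dots,x_4\}$ is a set of four collinear points, the set of vertices of a rhombus, or the set of vertices of a rectangle. Let it carry a symmetric distribution of masses (vorticities) $m_i\in\mathbb{R}\setminus\{0\}$, and suppose that $\varkappa$ is a relative equilibrium of the planar $4$-body problem with exponent $\gamma\ne-1$, or of the $4$-vortex problem ($\gamma=-1$). Let $A=M^{-1}D\nabla U_\gamma(\varkappa)$, respectively $A=M^{-1}D\nabla H_{-1}(\varkappa)$. Then in each of these cases there is an $M$-orthogonal basis of $\mathbb{R}^8$ of the form $\{Jv_1,v_1,Jv_2,v_2,Jv_3,v_3,Jv_4,v_4\}$ all of whose elements are eigenvectors of $A$; with respect to it, for every scalar $\beta$, the operator $A+\beta J$ is block-diagonal with four $2\times2$ blocks of the form $\begin{pmatrix} *&\beta\\-\beta&*\end{pmatrix}$, where the diagonal entries are eigenvalues of $A$. Consequently the stability polynomial $P_\gamma(\lambda)$ is the product of four polynomials of degree two (in $\lambda^2$ in the $4$-body case, in $\lambda$ in the $4$-vortex case), the determinants of the corresponding $2\times 2$ blocks. In particular, the stability polynomial of the rhombus in the $4$-body and $4$-vortex problems can always be fully factored in this way.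
   Context: $D_2=\{e,r,s,rs\}$ acts on $\mathbb{R}^2$ with $r$ the rotation by $\pi$ about the origin and $s$ the reflection in a line through the origin. A configuration $\varkappa=(x_1,\dots,x_N)$ with distinct $x_i\in\mathbb{R}^2$ is $D_2$-symmetric if $X=\{x_1,\dots,x_N\}$ is invariant under $D_2$; then $g\cdot x_j=x_{g(j)}$ defines an action on indices, and the mass distribution is symmetric if $m_{g(i)}=m_i$ for all $g\in D_2$ and all $i$. Here $N=4$. $M=\mathrm{diag}(m_1,m_1,\dots,m_N,m_N)$; $M$-orthogonality refers to the (possibly indefinite) inner product $\langle v,w\rangle_M=v^TMw$ on $\mathbb{R}^{2N}$. $J$ is the $2N\times2N$ block-diagonal matrix with $N$ diagonal blocks $\begin{pmatrix}0&-1\\1&0\end{pmatrix}$. $U_\gamma(\varkappa)=\frac1{2\gamma+2}\sum_{i<j}m_im_j\|x_i-x_j\|^{2\gamma+2}$ for $\gamma\in\mathbb{R}\setminus\{-1\}$ and $H_{-1}(\varkappa)=-\sum_{i<j}m_im_j\ln\|x_i-x_j\|$. Fix $\omega\in\mathbb{R}\setminus\{0\}$. $\varkappa$ is a relative equilibrium of the $N$-body problem if $\nabla U_\gamma(\varkappa)=\omega^2M\varkappa$, and of the $N$-vortex problem if $\nabla H_{-1}(\varkappa)=-\omega M\varkappa$. The stability polynomials are $P_\gamma(\lambda)=\det\big(M^{-1}D\nabla U_\gamma(\varkappa)+(\lambda^2-\omega^2)I_{2N}+2\lambda\omega J\big)$ for $\gamma\neq-1$ and $P_{-1}(\lambda)=\det\big(M^{-1}D\nabla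 H_{-1}(\varkappa)+\omega I_{2N}+\lambda J\big)$.
   Formalization: The eigenbasis and block-diagonal form of A+βJ are asserted only when the masses do not sum to zero and, unless γ=0, the moment of inertia is nonzero (otherwise A is not diagonalizable); the factorization of the stability polynomial is proved without these conditions. *)

(* Defs.v *)
From HB Require Import structures.
From mathcomp Require Import all_boot all_order all_fingroup all_algebra.
From mathcomp Require Import all_classical all_reals all_analysis.

Set Implicit Arguments.
Unset Strict Implicit.
Unset Printing Implicit Defensive.

Import Order.TTheory GRing.Theory Num.Theory.
Import numFieldNormedType.Exports.
Local Open Scope ring_scope.

(* A configuration of four points is a column x : 'cV[R]_8; rows 2i and 2i+1
   are the two coordinates of the point of index i. *)

Section Blocks.
Variable S : comNzRingType.

Definition blockdiag4 (D : 'I_4 -> 'M[S]_2) : 'M[S]_8 :=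
  \matrix_(p < 8, q < 8)
    if p./2 == q./2 then D (inord p./2) (inord (odd p)) (inord (odd q)) else 0.

Definition mx22 (a b c d : S) : 'M[S]_2 :=
  \matrix_(i < 2, j < 2)
    if i == 0 then (if j == 0 then a else b) else (if j == 0 then c else d).

Definition Jmx : 'M[S]_8 := blockdiag4 (fun=> mx22 0 (- 1) 1 0).

Definition skew_block (a b beta : S) : 'M[S]_2 := mx22 a beta (- beta) b.

Definition massmx (m : 'I_4 -> S) : 'M[S]_8 := blockdiag4 (fun i => (m i)%:M).

End Blocks.

Arguments Jmx {S}.

Section Configurations.
Variable R : realType.
Implicit Types (x v w : 'cV[R]_8) (m : 'I_4 -> R) (u y z : 'cV[R]_2).

Definition pt x (i : 'I_4) : 'cV[R]_2 := \col_(k < 2) x (inord (i.*2 + k)%N) 0.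

Definition dot y z : R := \sum_(k < 2) y k 0 * z k 0.

(* Euclidean norm: the norm `|_| of the library on matrices is the sup norm. *)
Definition enorm y : R := Num.sqrt (dot y y).

(* For a unit vector u, the reflection in the line spanned by u. *)
Definition reflection u : 'M[R]_2 := 2 *: (u *m u^T) - 1%:M.

(* -1 is the rotation by pi; the list is [:: e; r; s; r s]. *)
Definition D2 u : seq 'M[R]_2 :=
  [:: 1%:M; - 1%:M; reflection u; - 1%:M *m reflection u].

Definition D2_symmetric u x : Prop :=
  forall g, g \in D2 u -> forall i, exists j, g *m pt x i = pt x j.

(* For distinct points, g *m pt x i = pt x j says that j = g(i). *)
Definition D2_symmetric_masses u x m : Prop :=
  forall g, g \in D2 u -> forall i j, g *m pt x i = pt x j -> m j = m i.

Definition collinear_points x : Prop :=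
  exists y z, z != 0 /\ forall i, exists t : R, pt x i = y + t *: z.

(* In the next two definitions indices are added modulo 4. *)
Definition rhombus_vertices x : Prop :=
  exists s : {perm 'I_4}, forall i : 'I_4,
    enorm (pt x (s (i + 1)) - pt x (s i)) = enorm (pt x (s 1) - pt x (s 0)).

Definition rectangle_vertices x : Prop :=
  exists s : {perm 'I_4}, forall i : 'I_4,
    dot (pt x (s (i + 1)) - pt x (s i))
        (pt x (s (i + 1 + 1)) - pt x (s (i + 1))) = 0.

Definition grad (f : 'cV[R]_8 -> R) x : 'cV[R]_8 :=
  \col_(p < 8) 'D_(delta_mx p 0) f x.

Definition Dgrad (f : 'cV[R]_8 -> R) x : 'M[R]_8 :=
  \matrix_(p < 8, q < 8) 'D_(delta_mx q 0) (fun z : 'cV[R]_8 => grad f z p 0) x.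

Definition U_body (gamma : R) m x : R :=
  (2 * gamma + 2)^-1 *
  \sum_(i < 4) \sum_(j < 4 | (i < j)%N)
    m i * m j * enorm (pt x i - pt x j) `^ (2 * gamma + 2).

Definition H_vortex m x : R :=
  - \sum_(i < 4) \sum_(j < 4 | (i < j)%N)
      m i * m j * ln (enorm (pt x i - pt x j)).

Definition body_rel_eq (gamma omega : R) m x : Prop :=
  grad (U_body gamma m) x = omega ^+ 2 *: (massmx m *m x).

Definition vortex_rel_eq (omega : R) m x : Prop :=
  grad (H_vortex m) x = - omega *: (massmx m *m x).

Definition A_body (gamma : R) m x : 'M[R]_8 :=
  invmx (massmx m) *m Dgrad (U_body gamma m) x.

Definition A_vortex m x : 'M[R]_8 :=
  invmx (massmx m) *m Dgrad (H_vortex m) x.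

(* The stability polynomials, as formal polynomials in lambda = 'X. *)
Definition P_body (gamma omega : R) m x : {poly R} :=
  \det (map_mx polyC (A_body gamma m x) + ('X^2 - (omega ^+ 2)%:P)%:M
        + (2 * omega%:P * 'X) *: Jmx).

Definition P_vortex (omega : R) m x : {poly R} :=
  \det (map_mx polyC (A_vortex m x) + (omega%:P)%:M + 'X *: Jmx).

Definition Minner m v w : R := (v^T *m massmx m *m w) 0 0.

Definition is_eigenvector (A : 'M[R]_8) (mu : R) v : Prop :=
  v != 0 /\ A *m v = mu *: v.

Definition is_eigenvalue (A : 'M[R]_8) (mu : R) : Prop :=
  exists v, is_eigenvector A mu v.

(* The matrix with columns J v_1, v_1, J v_2, v_2, J v_3, v_3, J v_4, v_4. *)
Definition Jframe (v : 'I_4 -> 'cV[R]_8) : 'M[R]_8 :=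
  \matrix_(p < 8, q < 8)
    (if odd q then v (inord q./2) else Jmx *m v (inord q./2)) p 0.

(* The columns of Jframe v are an M-orthogonal basis of eigenvectors of A, with
   eigenvalues a 0, b 0, a 1, b 1, ..., in which A + beta J is block-diagonal. *)
Definition splits_A (A : 'M[R]_8) m (a b : 'I_4 -> R)
    (v : 'I_4 -> 'cV[R]_8) : Prop :=
  [/\ Jframe v \in unitmx,
      forall p q : 'I_8, p != q ->
        Minner m (col p (Jframe v)) (col q (Jframe v)) = 0,
      forall i, is_eigenvector A (a i) (Jmx *m v i) /\
                is_eigenvector A (b i) (v i) &
      forall beta : R,
        invmx (Jframe v) *m (A + beta *: Jmx) *m Jframe v =
        blockdiag4 (fun i => skew_block (a i) (b i) beta)].

(* Non-degeneracy needed for an eigenbasis to exist. If the total mass is 0,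
   translations are isotropic eigenvectors; if the moment of inertia is 0, so
   are x and J x. Then A may have nontrivial Jordan blocks: for vortices, take
   (+-(1 + sqrt 2), 0) of vorticity 1 and (0, +-1) of vorticity -1.
   For gamma = 0 the map grad U is linear and the second condition is idle. *)
Definition total_mass m : R := \sum_(i < 4) m i.

Definition inertia m x : R := Minner m x x.

Definition body_block (omega a b : R) : 'M[{poly R}]_2 :=
  skew_block (a%:P + ('X^2 - (omega ^+ 2)%:P)) (b%:P + ('X^2 - (omega ^+ 2)%:P))
             (2 * omega%:P * 'X).

Definition vortex_block (omega a b : R) : 'M[{poly R}]_2 :=
  skew_block (a%:P + omega%:P) (b%:P + omega%:P) 'X.

End Configurations.

(* Main.v *)
(* Only the rotation by pi is needed for the factorization. With rho the induced
   involution of the labels, R^8 splits into the fields with v_(rho i) = v_i and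
   those with v_(rho i) = - v_i; both 4-dimensional halves are preserved by A and
   by J, and are M-orthogonal.
   - Even half: the constant fields v, J v have eigenvalue 0. Their M-orthogonal
     complement is spanned by w and J w for a single w, and A is self-adjoint, so
     some combination v' = c w + s J w makes v', J v' eigenvectors.
   - Odd half: x and J x are eigenvectors (homogeneity and rotation invariance of
     the potential). In complex notation x = (p, -p, q, -q), and the complement is
     spanned by w = (m2 q^*, - m2 q^*, - m1 p^*, m1 p^* ) and J w, as before.
   If the total mass (resp. the moment of inertia) vanishes, then v (resp. x) is
   isotropic. Another isotropic field v' of the same half then pairs with it, and
   the frame dual to (v, v') is (v', v): A is block triangular instead of block
   diagonal and the determinant still factors. For gamma = 0 the operator A is
   scalar on the odd half, so any M-orthogonal frame will do there. *)
Require Import Defs.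
From HB Require Import structures.
From mathcomp Require Import all_boot all_order all_fingroup all_algebra.
From mathcomp Require Import ring lra.
From mathcomp Require Import all_classical all_reals all_analysis.
Import Order.TTheory GRing.Theory Num.Theory.
Import numFieldNormedType.Exports.
Local Open Scope ring_scope.
Set Implicit Arguments.
Unset Strict Implicit.
Unset Printing Implicit Defensive.

(** * Block matrices and frames *)

Definition idx (i : 'I_4) (k : 'I_2) : 'I_8 := inord (i.*2 + k).

Lemma val_idx i k : idx i k = (i.*2 + k)%N :> nat.
Proof.
rewrite inordK //.
by case: i => [[|[|[|[|?]]]]] //= _; case: k => [[|[|?]]].
Qed.

Lemma idx_half i k : (idx i k)./2 = i.
Proof.
rewrite val_idx halfD odd_double doubleK /=.
by case: k => [[|[|?]]] //= _; rewrite addn0.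
Qed.

Lemma odd_idx i k : odd (idx i k) = k :> nat.
Proof. by rewrite val_idx oddD odd_double; case: k => [[|[|?]]]. Qed.

Lemma inord_idx_half i k : inord (idx i k)./2 = i.
Proof. by rewrite idx_half inord_val. Qed.

Lemma inord_odd_idx i k : inord (odd (idx i k)) = k.
Proof. by rewrite odd_idx inord_val. Qed.

Lemma idxK (p : 'I_8) : idx (inord p./2) (inord (odd p)) = p.
Proof.
apply: val_inj; rewrite /= val_idx !inordK.
- by rewrite addnC odd_double_half.
- by case: (odd p).
- by rewrite ltn_half_double.
Qed.

(** Serves as an eliminator: [apply: idxP] trades an index of ['I_8] for a point label and a
    coordinate. *)
Lemma idxP (P : 'I_8 -> Prop) : (forall i k, P (idx i k)) -> forall p, P p.
Proof. by move=> h p; rewrite -(idxK p); apply: h. Qed.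

Lemma eq_idx i k j l : (idx i k == idx j l) = (i == j) && (k == l).
Proof.
apply/eqP/andP => [h|[/eqP-> /eqP->] //].
by rewrite -(inord_idx_half i k) -{2}(inord_odd_idx i k) h inord_idx_half inord_odd_idx.
Qed.

Lemma sum_idx (V : nmodType) (f : 'I_8 -> V) :
  \sum_p f p = \sum_i (f (idx i 0) + f (idx i 1)).
Proof.
rewrite (reindex (fun ik : 'I_4 * 'I_2 => idx ik.1 ik.2)) /=.
  rewrite -(pair_bigA _ (fun i k => f (idx i k))) /=; apply: eq_bigr => i _.
  by rewrite !big_ord_recl big_ord0 addr0; congr (_ + f (idx _ _)); apply: val_inj.
exists (fun p => (inord p./2, inord (odd p))) => [[i k]|p] _ /=.
  by rewrite inord_idx_half inord_odd_idx.
exact: idxK.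
Qed.

Lemma ord2P (P : 'I_2 -> Prop) : P 0 -> P 1 -> forall k, P k.
Proof.
move=> h0 h1 [[|[|//]] hk].
  by rewrite (_ : Ordinal hk = 0) //; apply: val_inj.
by rewrite (_ : Ordinal hk = 1) //; apply: val_inj.
Qed.

Lemma ord4P (P : 'I_4 -> Prop) : P 0 -> P 1 -> P 2 -> P 3 -> forall i, P i.
Proof.
move=> h0 h1 h2 h3 [[|[|[|[|//]]]] hk].
- by rewrite (_ : Ordinal hk = 0) //; apply: val_inj.
- by rewrite (_ : Ordinal hk = 1) //; apply: val_inj.
- by rewrite (_ : Ordinal hk = 2) //; apply: val_inj.
- by rewrite (_ : Ordinal hk = 3) //; apply: val_inj.
Qed.

Lemma sum_ord2 (V : nmodType) (f : 'I_2 -> V) : \sum_k f k = f 0 + f 1.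
Proof. by rewrite !big_ord_recl big_ord0 addr0; congr (_ + f _); apply: val_inj. Qed.

Lemma blockdiag4E (S : comNzRingType) (D : 'I_4 -> 'M[S]_2) i k j l :
  blockdiag4 D (idx i k) (idx j l) = if i == j then D i k l else 0.
Proof. by rewrite mxE !idx_half inord_val !inord_odd_idx. Qed.

Lemma blockdiag4M (S : comNzRingType) (D E : 'I_4 -> 'M[S]_2) :
  blockdiag4 D *m blockdiag4 E = blockdiag4 (fun i => D i *m E i).
Proof.
apply/matrixP; apply: idxP => i k; apply: idxP => j l.
rewrite mxE sum_idx blockdiag4E (bigD1 i) //= !blockdiag4E eqxx big1 ?addr0.
  by case: eqP => [->|_]; rewrite ?mulr0 ?addr0 // mxE sum_ord2.
by move=> i' i'i; rewrite !blockdiag4E eq_sym (negPf i'i) !mul0r addr0.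
Qed.

(** Splitting off the top left 2 by 2 block factors the determinant; this is done for the sizes 2 +
    6, 2 + 4 and 2 + 2. *)
Lemma det_block_triangular (S : comNzRingType) (T : 'M[S]_8) :
  (forall (i j : 'I_4) k l, (j < i)%N -> T (idx i k) (idx j l) = 0) ->
  \det T = \prod_i \det (\matrix_(k < 2, l < 2) T (idx i k) (idx i l)).
Proof.
move=> T0.
have dlE (n : nat) (T' : 'M[S]_(2 + n)) : dlsubmx T' = 0 ->
    \det T' = \det (ulsubmx T') * \det (drsubmx T').
  by move=> h; rewrite -{1}[T']submxK h det_ublock.
have T0' (p q : 'I_8) : (q./2 < p./2)%N -> T p q = 0.
  by rewrite -(idxK p) -(idxK q) !idx_half; apply: T0.
(* The sizes 8 and 2 + 6 are convertible, so the block operations apply without a cast. *)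
pose T1 : 'M[S]_(2 + 6) := T.
have h1 : dlsubmx T1 = 0.
  apply/matrixP => i j; rewrite !mxE /T1.
  by apply: T0'; case: j => [[|[|?]]].
pose T2 : 'M[S]_(2 + 4) := drsubmx T1.
have h2 : dlsubmx T2 = 0.
  apply/matrixP => i j; rewrite !mxE /T1.
  by apply: T0'; case: j => [[|[|?]]].
pose T3 : 'M[S]_(2 + 2) := drsubmx T2.
have h3 : dlsubmx T3 = 0.
  apply/matrixP => i j; rewrite !mxE /T1.
  by apply: T0'; case: j => [[|[|?]]].
have -> : \det T = \det T1 by [].
rewrite (dlE _ _ h1) -/T2 (dlE _ _ h2) -/T3 (dlE _ _ h3).
rewrite !big_ord_recl big_ord0 mulr1.
congr (_ * (_ * (_ * _))); congr (\det _);
  apply/matrixP => i j; rewrite !mxE; congr (T _ _);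
  by apply: val_inj; rewrite /= val_idx.
Qed.

(** * Bilinear forms and the frames [J v_i, v_i] *)

Section Frames.
Variable R : realType.
Implicit Types (x v w : 'cV[R]_8) (m : 'I_4 -> R) (D A : 'M[R]_8).

Definition bil D v w : R := (v^T *m D *m w) 0 0.

Lemma MinnerE m v w : Minner m v w = bil (massmx m) v w.
Proof. by []. Qed.

Lemma bilE D v w : bil D v w = \sum_p \sum_q v p 0 * D p q * w q 0.
Proof.
rewrite /bil mxE exchange_big; apply: eq_bigr => q _.
by rewrite mxE mulr_suml; apply: eq_bigr => p _; rewrite mxE.
Qed.

Lemma bilDl D v v' w : bil D (v + v') w = bil D v w + bil D v' w.
Proof. by rewrite /bil linearD !mulmxDl mxE. Qed.

Lemma bilDr D v w w' : bil D v (w + w') = bil D v w + bil D v w'.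
Proof. by rewrite /bil mulmxDr mxE. Qed.

Lemma bilZl D c v w : bil D (c *: v) w = c * bil D v w.
Proof. by rewrite /bil linearZ -!scalemxAl mxE. Qed.

Lemma bilZr D c v w : bil D v (c *: w) = c * bil D v w.
Proof. by rewrite /bil -scalemxAr mxE. Qed.

Lemma bilNr D v w : bil D v (- w) = - bil D v w.
Proof. by rewrite -scaleN1r bilZr mulN1r. Qed.

Lemma bilC D v w : D^T = D -> bil D v w = bil D w v.
Proof.
move=> Dt; rewrite !bilE exchange_big; apply: eq_bigr => p _; apply: eq_bigr => q _.
have -> : D q p = D p q by rewrite -{1}Dt mxE.
by ring.
Qed.

Lemma gramE D (F G : 'M[R]_8) p q : (G^T *m D *m F) p q = bil D (col p G) (col q F).
Proof.
rewrite bilE mxE exchange_big; apply: eq_bigr => j _.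
rewrite mxE mulr_suml; apply: eq_bigr => i _.
by rewrite !mxE.
Qed.

Lemma JmxJ v : Jmx *m (Jmx *m v) = - v :> 'cV[R]_8.
Proof.
rewrite mulmxA blockdiag4M -[in RHS](mul1mx v) -mulNmx; congr (_ *m v).
apply/matrixP; apply: idxP => i k; apply: idxP => j l.
rewrite blockdiag4E !mxE eq_idx sum_ord2 !mxE.
by case: eqP => _ /=; rewrite ?oppr0 //; elim/ord2P: k; elim/ord2P: l => /=; ring.
Qed.

Lemma col_Jframe1 (v : 'I_4 -> 'cV[R]_8) i : col (idx i 1) (Jframe v) = v i.
Proof.
by apply/matrixP => p j; rewrite !mxE inord_idx_half val_idx oddD odd_double ord1.
Qed.

Lemma col_Jframe0 (v : 'I_4 -> 'cV[R]_8) i : col (idx i 0) (Jframe v) = Jmx *m v i.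
Proof.
by apply/matrixP => p j; rewrite !mxE inord_idx_half val_idx oddD odd_double ord1 mxE.
Qed.

Definition col_Jframe := (col_Jframe0, col_Jframe1).

Lemma col_mul_blockdiag4 (F : 'M[R]_8) (D : 'I_4 -> 'M[R]_2) i k :
  col (idx i k) (F *m blockdiag4 D) =
  D i 0 k *: col (idx i 0) F + D i 1 k *: col (idx i 1) F.
Proof.
apply/matrixP => p j; rewrite !mxE sum_idx (bigD1 i) //= !blockdiag4E eqxx.
rewrite big1 ?addr0 => [|i' /negPf i'i]; first by rewrite ![_ * F _ _]mulrC.
by rewrite !blockdiag4E i'i !mulr0 addr0.
Qed.

Lemma eq_col_idx (F G : 'M[R]_8) :
  (forall i, col (idx i 0) F = col (idx i 0) G /\ col (idx i 1) F = col (idx i 1) G) ->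
  F = G.
Proof.
move=> h; apply/matrixP => p; apply: idxP => i k.
have [h0 h1] := h i.
elim/ord2P: k.
  by have := congr1 (fun c : 'cV_8 => c p 0) h0; rewrite !mxE.
by have := congr1 (fun c : 'cV_8 => c p 0) h1; rewrite !mxE.
Qed.

Lemma col_mulmx (A F : 'M[R]_8) q : col q (A *m F) = A *m col q F.
Proof. by rewrite !colE mulmxA. Qed.

(** Since [J (J v) = - v], the matrix of [J] is the same in every such frame; it fixes the signs in
    [skew_block]. *)
Lemma Jmx_Jframe (v : 'I_4 -> 'cV[R]_8) :
  Jmx *m Jframe v = Jframe v *m blockdiag4 (fun=> mx22 0 1 (- 1) 0).
Proof.
apply: eq_col_idx => i; rewrite !col_mul_blockdiag4 !mxE /= !col_mulmx !col_Jframe.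
by rewrite JmxJ !scale0r add0r addr0 scale1r scaleN1r.
Qed.

Lemma massmx_unit m : (forall i, m i != 0) -> massmx m \in unitmx.
Proof.
move=> m0; suff /mulmx1_unit[] : massmx m *m massmx (fun i => (m i)^-1) = 1%:M by [].
rewrite /massmx blockdiag4M; apply/matrixP; apply: idxP => i k; apply: idxP => j l.
rewrite blockdiag4E !mxE eq_idx sum_ord2 !mxE.
case: eqP => _ //=; elim/ord2P: k; elim/ord2P: l => /=;
  by rewrite ?mulr1n ?mulr0n ?mulr0 ?mul0r ?addr0 ?add0r ?divff.
Qed.

Section Gram.
Variables (m : 'I_4 -> R) (D : 'M[R]_8) (v w : 'I_4 -> 'cV[R]_8) (n : 'I_4 -> R).
Hypothesis m0 : forall i, m i != 0.
Hypothesis n0 : forall i, n i != 0.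
Hypothesis Mvw : forall i j, Minner m (w i) (v j) = if i == j then n i else 0.
Hypothesis Mvw' : forall i j, Minner m (Jmx *m w i) (Jmx *m v j) = if i == j then n i else 0.
Hypothesis Mvw0 : forall i j, Minner m (w i) (Jmx *m v j) = 0.
Hypothesis Mvw1 : forall i j, Minner m (Jmx *m w i) (v j) = 0.

Let F := Jframe v.
Let G := Jframe w.
Let N := blockdiag4 (fun i => (n i)%:M : 'M[R]_2).
Let N' := massmx (fun i => (n i)^-1).

Lemma gram_mass : G^T *m massmx m *m F = N.
Proof.
apply/matrixP; apply: idxP => i k; apply: idxP => j l.
rewrite gramE blockdiag4E mxE -MinnerE.
by elim/ord2P: k; elim/ord2P: l; rewrite !col_Jframe ?Mvw ?Mvw' ?Mvw0 ?Mvw1 /=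
  ?mulr1n ?mulr0n; case: (i == j).
Qed.

Lemma Jframe_unit : F \in unitmx.
Proof.
(* The diagonal matrix [N] has the shape of a mass matrix, and [F] is one of its factors. *)
have : N \in unitmx by apply: massmx_unit.
by rewrite -gram_mass unitmx_mul => /andP[].
Qed.

(** The relation [G^T M F = N] makes [N^-1 G^T M] the inverse of [F], so [M^-1 D] becomes
    [N^-1 (G^T D F)] in the frame [F]. *)
Lemma mul_Jframe : invmx (massmx m) *m D *m F = F *m (invmx N *m (G^T *m D *m F)).
Proof.
have Nu : N \in unitmx by apply: massmx_unit.
have Mu := massmx_unit m0.
have GMu : G^T *m massmx m \in unitmx.
  by move: Nu; rewrite -gram_mass unitmx_mul => /andP[].
apply: (can_inj (mulKmx GMu)).
rewrite !mulmxA -(mulmxA G^T) mulmxV // mulmx1 gram_mass.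
by rewrite mulmxV // mul1mx.
Qed.

End Gram.

End Frames.

(** * The pencil [A + c + y J] in dual frames *)

Section Pencil.
Variable R : realType.
Implicit Types (x v w : 'cV[R]_8) (m : 'I_4 -> R) (D A : 'M[R]_8).

Lemma ptE v i k : pt v i k 0 = v (idx i k) 0.
Proof. by rewrite mxE. Qed.

Lemma dotE (y z : 'cV[R]_2) : dot y z = y 0 0 * z 0 0 + y 1 0 * z 1 0.
Proof. by rewrite /dot sum_ord2. Qed.

Lemma dotC (y z : 'cV[R]_2) : dot y z = dot z y.
Proof. by rewrite !dotE; ring. Qed.

Lemma pt_blockdiag4 (B : 'I_4 -> 'M[R]_2) v i : pt (blockdiag4 B *m v) i = B i *m pt v i.
Proof.
apply/matrixP => k l; rewrite ord1 ptE !mxE sum_ord2 sum_idx (bigD1 i) //=.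
rewrite big1 => [|j /negPf ji]; last by rewrite !blockdiag4E eq_sym ji !mul0r addr0.
by rewrite !blockdiag4E eqxx addr0 !ptE.
Qed.

Lemma ptJ v i : (pt (Jmx *m v) i 0 0 = - pt v i 1 0) * (pt (Jmx *m v) i 1 0 = pt v i 0 0).
Proof. by rewrite pt_blockdiag4 !mxE !sum_ord2 !mxE /=; split; ring. Qed.

Lemma Minner_sum m v w : Minner m v w = \sum_i m i * dot (pt v i) (pt w i).
Proof.
rewrite /Minner -mulmxA mxE sum_idx; apply: eq_bigr => i _.
rewrite !(mxE trmx_key) -!ptE pt_blockdiag4 mul_scalar_mx dotE !(mxE scalemx_key).
by ring.
Qed.

Lemma MinnerJ m v w : Minner m (Jmx *m v) (Jmx *m w) = Minner m v w.
Proof. by rewrite !Minner_sum; apply: eq_bigr => i _; rewrite !dotE !ptJ; ring. Qed.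

Lemma MinnerJl m v w : Minner m (Jmx *m v) w = - Minner m v (Jmx *m w).
Proof.
by rewrite !Minner_sum -sumrN; apply: eq_bigr => i _; rewrite !dotE !ptJ; ring.
Qed.

Lemma MinnerC m v w : Minner m v w = Minner m w v.
Proof. by rewrite !Minner_sum; apply: eq_bigr => i _; rewrite !dotE; ring. Qed.

Section Frame.
Variable I : finType.
Implicit Types (n a b : I -> R) (f g : I -> 'cV[R]_8).

(** The pairings of [J g i] follow from these, because [J] is an [M]-isometry and [M]-skew. Two
    frames are allowed because an isotropic field must be dual to a field other than itself. *)
Definition dual_frames m n g f := forall i j,
  Minner m (g i) (f j) = (if i == j then n i else 0) /\ Minner m (g i) (Jmx *m f j) = 0.

(** A condition on one pair of indices, so that it can be imposed on all pairs (diagonal matrix) or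
    only for [j <= i] (block triangular matrix). The value [b] belongs to [f], the value [a] to
    [J f]. *)
Definition diag_pair D n a b g f (i j : I) :=
  [/\ bil D (g i) (f j) = (if i == j then n i * b i else 0),
      bil D (Jmx *m g i) (Jmx *m f j) = (if i == j then n i * a i else 0),
      bil D (g i) (Jmx *m f j) = 0 &
      bil D (Jmx *m g i) (f j) = 0].
End Frame.

(** Both stability polynomials are [det (A + c + y J)] with [c] and [y] polynomials in lambda. The
    constant change of basis [F] makes the pencil block triangular, and [y] only enters its diagonal
    blocks. *)
Lemma det_pencil A (F T : 'M[R]_8) (a b : 'I_4 -> R) (c y : {poly R}) :
  F \in unitmx -> A *m F = F *m T -> Jmx *m F = F *m blockdiag4 (fun=> mx22 0 1 (- 1) 0) ->
  (forall (i j : 'I_4) k l, (j < i)%N -> T (idx i k) (idx j l) = 0) ->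
  (forall i k l, T (idx i k) (idx i l) = mx22 (a i) 0 0 (b i) k l) ->
  \det (map_mx polyC A + c%:M + y *: Jmx) =
  \prod_i \det (skew_block ((a i)%:P + c) ((b i)%:P + c) y).
Proof.
move=> Fu AF JF T0 Td.
pose F' := map_mx polyC F.
have F'u : \det F' != 0 by rewrite det_map_mx polyC_eq0 -unitfE -unitmxE.
pose T' := map_mx polyC T + c%:M + y *: blockdiag4 (fun=> mx22 0 1 (- 1) 0).
have JF' : Jmx *m F' = F' *m blockdiag4 (fun=> mx22 0 1 (- 1) 0).
  have mapB (B : 'M[R]_2) (B' : 'M[{poly R}]_2) : map_mx polyC B = B' ->
      map_mx polyC (blockdiag4 (fun=> B)) = blockdiag4 (fun=> B').
    move=> <-; apply/matrixP; apply: idxP => i k; apply: idxP => j l.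
    by rewrite mxE !blockdiag4E; case: eqP => //; rewrite ?mxE // polyC0.
  have mapS (p q r s : R) (p' q' r' s' : {poly R}) :
      p%:P = p' -> q%:P = q' -> r%:P = r' -> s%:P = s' ->
      map_mx polyC (mx22 p q r s) = mx22 p' q' r' s'.
    move=> <- <- <- <-; apply/matrixP => i j; rewrite !mxE.
    by elim/ord2P: i; elim/ord2P: j.
  rewrite -(mapB (mx22 0 1 (-1) 0)); last by apply: mapS; rewrite ?polyCN.
  rewrite -map_mxM -JF map_mxM; congr (_ *m _); apply/esym/mapB.
  by apply: mapS; rewrite ?polyCN.
have : (map_mx polyC A + c%:M + y *: Jmx) *m F' = F' *m T'.
  rewrite !mulmxDl !mulmxDr -scalemxAl -scalemxAr JF' -!map_mxM AF.
  by rewrite mul_scalar_mx mul_mx_scalar.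
(* Taking determinants, the nonzero constant [\det F'] cancels from both sides. *)
move/(congr1 (fun M => \det M)); rewrite !det_mulmx mulrC => /(mulfI F'u) ->.
rewrite det_block_triangular => [|i j k l ji].
  apply: eq_bigr => i _; congr (\det _); apply/matrixP => k l.
  rewrite !mxE eq_idx !idx_half !eqxx Td !inord_odd_idx !mxE.
  by elim/ord2P: k; elim/ord2P: l => /=; rewrite ?polyC0; ring.
have ij : (i == j) = false by rewrite -val_eqE gtn_eqF.
rewrite !mxE eq_idx T0 // !idx_half (gtn_eqF ji) ij.
by rewrite polyC0 mulr0n mulr0 !addr0.
Qed.

(** For [y = 0] and [c = - mu] the product contains the factor [(a i - mu) (b i - mu)]. Hence the
    diagonal entries are eigenvalues even when there is no eigenbasis. *)
Lemma det_pencil_eigenvalue A (a b : 'I_4 -> R) i :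
  (forall c y : {poly R}, \det (map_mx polyC A + c%:M + y *: Jmx) =
     \prod_i \det (skew_block ((a i)%:P + c) ((b i)%:P + c) y)) ->
  is_eigenvalue A (a i) /\ is_eigenvalue A (b i).
Proof.
move=> detA.
have detS (p q : {poly R}) : \det (skew_block p q 0) = p * q.
  rewrite (expand_det_row _ 0) sum_ord2 /cofactor !det_mx11 !mxE /=.
  by rewrite expr0 mul1r mul0r addr0.
have eig mu : (a i == mu) || (b i == mu) -> is_eigenvalue A mu.
  move=> e; have : \det (A - mu%:M) = 0.
    apply: polyC_inj; rewrite -det_map_mx polyC0.
    have := detA (- mu%:P) 0; rewrite scale0r addr0 (bigD1 i) //= detS.
    have -> : map_mx polyC (A - mu%:M) = map_mx polyC A + (- mu%:P)%:M.
      by rewrite map_mxB /= map_scalar_mx raddfN.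
    move=> ->; rewrite -!polyCN -!polyCD -polyCM.
    by case/orP: e => /eqP ->; rewrite subrr ?mul0r ?mulr0 ?polyC0 ?mul0r.
  (* [det0P] yields a row vector of the left kernel, hence the transposition. *)
  move/eqP; rewrite -det_tr => /det0P[v v0 vA]; exists v^T; split.
    by rewrite -trmx0 (inj_eq trmx_inj).
  apply/eqP; rewrite -subr_eq0 -mul_scalar_mx -mulmxBl.
  by rewrite -[_ - _]trmxK -trmx_mul vA trmx0.
by split; apply: eig; rewrite eqxx ?orbT.
Qed.

Lemma dual_frames_gram m n g f : (forall i, m i != 0) -> (forall i, n i != 0) ->
  dual_frames m n g f ->
  Jframe f \in unitmx /\
  forall D, invmx (massmx m) *m D *m Jframe f =
    Jframe f *m \matrix_(p, q) ((n (inord p./2))^-1 *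
      bil D (col p (Jframe g)) (col q (Jframe f))).
Proof.
move=> m0 n0 gf.
have h1 i j : Minner m (g i) (f j) = if i == j then n i else 0 by case: (gf i j).
have h2 i j : Minner m (Jmx *m g i) (Jmx *m f j) = if i == j then n i else 0.
  by rewrite MinnerJ h1.
have h3 i j : Minner m (g i) (Jmx *m f j) = 0 by case: (gf i j).
have h4 i j : Minner m (Jmx *m g i) (f j) = 0 by rewrite MinnerJl h3 oppr0.
split=> [|D]; first exact: (Jframe_unit n0 h1 h2 h3 h4).
rewrite (mul_Jframe D m0 n0 h1 h2 h3 h4); congr (_ *m _).
have Nu := massmx_unit n0; apply: (can_inj (mulKmx Nu)); rewrite mulKVmx //.
apply/matrixP; apply: idxP => i k; apply: idxP => j l.
rewrite gramE mxE sum_idx (bigD1 i) //= big1 => [|i' /negPf i'i].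
  rewrite !blockdiag4E eqxx addr0 !mxE !inord_idx_half.
  by elim/ord2P: k => /=; rewrite mulr1n mulr0n mul0r ?addr0 ?add0r mulVKf.
by rewrite !blockdiag4E eq_sym i'i !mul0r addr0.
Qed.

(** In the frame [f] the matrix of [M^-1 D] is the Gram matrix of [D] between [g] and [f], with rows
    divided by [n i]. The pairs [j < i] give zero blocks, the pairs [i = j] the blocks with diagonal
    [a i], [b i]; the blocks above are free. *)
Lemma triangular_pencil m n D a b g f :
  (forall i, m i != 0) -> (forall i, n i != 0) -> dual_frames m n g f ->
  (forall i j : 'I_4, (j <= i)%N -> diag_pair D n a b g f i j) ->
  forall c y : {poly R},
    \det (map_mx polyC (invmx (massmx m) *m D) + c%:M + y *: Jmx) =
    \prod_i \det (skew_block ((a i)%:P + c) ((b i)%:P + c) y).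
Proof.
move=> m0 n0 gf tri c y.
have [Fu /(_ D) DF] := dual_frames_gram m0 n0 gf.
apply: (det_pencil _ _ Fu DF (Jmx_Jframe f)) => [i j k l ji|i k l].
  rewrite mxE; have [h1 h2 h3 h4] := tri _ _ (ltnW ji).
  move: h1 h2; rewrite -val_eqE gtn_eqF // => h1 h2.
  by elim/ord2P: k; elim/ord2P: l; rewrite !col_Jframe ?(h1, h2, h3, h4) mulr0.
rewrite mxE inord_idx_half; have [h1 h2 h3 h4] := tri i i (leqnn i).
move: h1 h2; rewrite eqxx => h1 h2.
by elim/ord2P: k; elim/ord2P: l; rewrite !col_Jframe ?(h1, h2, h3, h4) !mxE /= ?mulr0 ?mulKf.
Qed.

Lemma diagonal_splits m n D a b f :
  (forall i, m i != 0) -> (forall i, n i != 0) -> dual_frames m n f f ->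
  (forall i j : 'I_4, diag_pair D n a b f f i j) ->
  splits_A (invmx (massmx m) *m D) m a b f.
Proof.
move=> m0 n0 ff diag.
have [Fu /(_ D) DF] := dual_frames_gram m0 n0 ff.
set A := invmx _ *m D in DF *.
have {}DF : A *m Jframe f = Jframe f *m blockdiag4 (fun i => mx22 (a i) 0 0 (b i)).
  rewrite DF; congr (_ *m _).
  apply/matrixP; apply: idxP => i k; apply: idxP => j l.
  rewrite mxE inord_idx_half blockdiag4E !mxE; have [h1 h2 h3 h4] := diag i j.
  elim/ord2P: k; elim/ord2P: l; rewrite !col_Jframe ?(h1, h2, h3, h4) /=;
  by case: eqP => _; rewrite ?mulr0 ?mulKf.
(* A zero column would make the determinant vanish. *)
have colF q : col q (Jframe f) != 0.
  apply: contraTneq Fu => F0; rewrite unitmxE unitfE negbK.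
  rewrite (expand_det_col _ q) big1 // => i _.
  have := congr1 (fun c : 'cV_8 => c i 0) F0.
  by rewrite !mxE => ->; rewrite mul0r.
split=> //.
- apply: idxP => i k; apply: idxP => j l; rewrite eq_idx.
  have [e1 e2] := ff i j.
  elim/ord2P: k; elim/ord2P: l; rewrite !col_Jframe /= ?andbT ?andbF;
  rewrite ?MinnerJ ?MinnerJl ?e1 ?e2 ?oppr0 //;
  by move=> /negPf ->.
- move=> i; split; split.
  + by rewrite -col_Jframe0.
  + by rewrite -col_Jframe0 -col_mulmx DF col_mul_blockdiag4 !mxE /= scale0r addr0.
  + by rewrite -col_Jframe1.
  + by rewrite -col_Jframe1 -col_mulmx DF col_mul_blockdiag4 !mxE /= scale0r add0r.
- move=> beta; rewrite -mulmxA; apply: (can_inj (mulKmx Fu)); rewrite mulKVmx //.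
  rewrite mulmxDl -scalemxAl DF Jmx_Jframe scalemxAr -mulmxDr; congr (_ *m _).
  apply/matrixP; apply: idxP => i k; apply: idxP => j l.
  rewrite mxE [X in _ + X]mxE !blockdiag4E.
  case: eqP => _; last by rewrite mulr0 addr0.
  by rewrite !mxE; elim/ord2P: k; elim/ord2P: l => /=; ring.
Qed.
End Pencil.

(** * Pair potentials and their derivatives *)

Section Potential.
Local Open Scope classical_set_scope.
Local Open Scope ring_scope.
Variable R : realType.
Implicit Types (x v w z : 'cV[R]_8) (m : 'I_4 -> R).

Definition dif z (i j : 'I_4) : 'cV[R]_2 := pt z i - pt z j.

Lemma difE z i j k : dif z i j k 0 = z (idx i k) 0 - z (idx j k) 0.
Proof. by rewrite /dif !mxE. Qed.

(** [Phi] takes the squared distance, which is polynomial in the coordinates. With [phi] for [Phi']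
    and [chi] for [Phi''], the forms [pair_grad] and [pair_hess] are the first and second
    differentials. *)
Definition pair_potential (Phi : R -> R) m z : R :=
  \sum_(i < 4) \sum_(j < 4 | (i < j)%N) m i * m j * Phi (dot (dif z i j) (dif z i j)).

Definition pair_grad (phi : R -> R) m z w : R :=
  \sum_(i < 4) \sum_(j < 4 | (i < j)%N)
    m i * m j * (2 * phi (dot (dif z i j) (dif z i j)) * dot (dif z i j) (dif w i j)).

Definition pair_hess (phi chi : R -> R) m z v w : R :=
  \sum_(i < 4) \sum_(j < 4 | (i < j)%N)
    m i * m j * (2 * phi (dot (dif z i j) (dif z i j)) * dot (dif v i j) (dif w i j) +
      4 * chi (dot (dif z i j) (dif z i j)) *
        (dot (dif z i j) (dif v i j) * dot (dif z i j) (dif w i j))).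

(** Along a line squared distances are quadratic polynomials in [t], so differentiation reduces to
    one real variable. *)
Lemma derive_line (f : 'cV[R]_8 -> R) z w :
  'D_w f z = 'D_1 (fun t : R => f (t *: w + z)) 0.
Proof.
rewrite /derive; set g := fun t : R => f (t *: w + z).
suff -> : (fun h : R => h^-1 *: ((f \o shift z) (h *: w) - f z)) =
  (fun h : R => h^-1 *: ((g \o shift 0) (h *: 1) - g 0)) by [].
apply/funext => h; rewrite /g /= addr0 scale0r add0r.
by rewrite [h *: 1]mulr1.
Qed.

Lemma is_derive_bigsum (I : Type) (r : seq I) (P : pred I) (h : I -> R -> R)
    (dh : I -> R) (t : R) :
  (forall i, P i -> is_derive t 1 (h i) (dh i)) ->
  is_derive t 1 (fun s => \sum_(i <- r | P i) h i s) (\sum_(i <- r | P i) dh i).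
Proof.
move=> hd; elim: r => [|i r IH].
  rewrite big_nil (_ : (fun _ => _) = cst 0); first exact: is_derive_cst.
  by apply/funext => s; rewrite big_nil.
rewrite big_cons (_ : (fun _ => _) =
  fun s => if P i then h i s + \sum_(j <- r | P j) h j s else \sum_(j <- r | P j) h j s).
  by case: ifP => // Pi; apply: is_deriveD => //; apply: hd.
by apply/funext => s; rewrite big_cons.
Qed.

Lemma dot_dif_line z w v i j (t : R) :
  dot (dif (t *: w + z) i j) (dif v i j) =
  ((dot (dif z i j) (dif v i j))%:P + dot (dif w i j) (dif v i j) *: 'X).[t].
Proof. by rewrite !hornerE /= !dotE !difE !mxE; ring. Qed.

Lemma sq_dif_line z w i j (t : R) :
  dot (dif (t *: w + z) i j) (dif (t *: w + z) i j) =
  ((dot (dif z i j) (dif z i j))%:P + (2 * dot (dif z i j) (dif w i j)) *: 'X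
     + dot (dif w i j) (dif w i j) *: 'X^2).[t].
Proof. by rewrite !hornerE /= !dotE !difE !mxE; ring. Qed.

Lemma is_derive_quadratic (g : R -> R) (a b c : R) :
  (forall t, g t = (a%:P + b *: 'X + c *: 'X^2).[t]) -> is_derive (0 : R) 1 g b.
Proof.
move=> /funext ->; have := is_derive_poly (a%:P + b *: 'X + c *: 'X^2) (0 : R).
suff -> : (a%:P + b *: 'X + c *: 'X^2)^`().[0] = b by [].
by rewrite !derivD derivC !derivZ derivX derivXn !hornerE /=.
Qed.

Lemma is_derive_dot_dif z w v i j :
  is_derive (0 : R) 1 (fun t => dot (dif (t *: w + z) i j) (dif v i j))
    (dot (dif w i j) (dif v i j)).
Proof.
apply: (is_derive_quadratic (a := dot (dif z i j) (dif v i j)) (c := 0)) => t.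
by rewrite scale0r addr0 dot_dif_line.
Qed.

Lemma is_derive_sq_dif z w i j :
  is_derive (0 : R) 1 (fun t => dot (dif (t *: w + z) i j) (dif (t *: w + z) i j))
    (2 * dot (dif z i j) (dif w i j)).
Proof. exact: is_derive_quadratic (sq_dif_line z w i j). Qed.

Definition pairwise_separated z := forall i j : 'I_4, i != j -> 0 < dot (dif z i j) (dif z i j).

(** The gradient formula holds away from collisions; to differentiate it once more it must hold on a
    neighbourhood. *)
Lemma near_pairwise_separated z w : pairwise_separated z ->
  \forall t \near (0 : R), pairwise_separated (t *: w + z).
Proof.
move=> sz.
pose P i j t := i != j -> 0 < dot (dif (t *: w + z) i j) (dif (t *: w + z) i j).
have FF : Filter (nbhs (0 : R)) by apply: nbhs_filter.
(* There are finitely many pairs, so one neighbourhood serves them all. *)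
apply: (filter_forall (f := fun i t => forall j, P i j t) FF) => i.
apply: (filter_forall (f := fun j t => P i j t) FF) => j; rewrite /P.
case: (eqVneq i j) => [_|ij]; first by apply: (@filterE _ _ FF) => t.
have [/derivable1_diffP/differentiable_continuous c _] := is_derive_sq_dif z w i j.
have pos : 0 < dot (dif (0 *: w + z) i j) (dif (0 *: w + z) i j).
  by rewrite scale0r add0r; exact: sz.
by apply: (@filterS _ _ FF _ _ _ (cvgr_gt _ c 0 pos)) => t h _.
Qed.

Section Smooth.
Variables (Phi phi chi : R -> R).
Hypothesis dPhi : forall s : R, 0 < s -> is_derive s 1 Phi (phi s).
Hypothesis dphi : forall s : R, 0 < s -> is_derive s 1 phi (chi s).

Lemma derive_pair_potential m z w : pairwise_separated z ->
  'D_w (pair_potential Phi m) z = pair_grad phi m z w.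
Proof.
move=> sz; rewrite derive_line.
suff H : is_derive (0 : R) 1 (fun t : R => pair_potential Phi m (t *: w + z)) (pair_grad phi m z w).
  exact: derive_val.
apply: is_derive_bigsum => i _; apply: is_derive_bigsum => j ij.
apply: is_deriveZ.
set g := fun t : R => dot (dif (t *: w + z) i j) (dif (t *: w + z) i j).
have g0 : g 0 = dot (dif z i j) (dif z i j) by rewrite /g scale0r add0r.
rewrite -mulrA mulrCA -g0; apply: (is_derive1_comp (f := Phi) (g := g)).
  by apply: dPhi; rewrite g0; apply: sz; rewrite -val_eqE ltn_eqF.
exact: is_derive_sq_dif.
Qed.

Lemma derive_pair_grad m z v w : pairwise_separated z ->
  'D_w (fun y => pair_grad phi m y v) z = pair_hess phi chi m z v w.
Proof.
move=> sz; rewrite derive_line.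
suff H : is_derive (0 : R) 1 (fun t : R => pair_grad phi m (t *: w + z) v)
    (pair_hess phi chi m z v w).
  exact: derive_val.
apply: is_derive_bigsum => i _; apply: is_derive_bigsum => j ij.
apply: is_deriveZ.
set g := fun t : R => dot (dif (t *: w + z) i j) (dif (t *: w + z) i j).
set h := fun t : R => dot (dif (t *: w + z) i j) (dif v i j).
have g0 : g 0 = dot (dif z i j) (dif z i j) by rewrite /g scale0r add0r.
have h0 : h 0 = dot (dif z i j) (dif v i j) by rewrite /h scale0r add0r.
have dg : is_derive (0 : R) 1 (phi \o g) (chi (g 0) * (2 * dot (dif z i j) (dif w i j))).
  apply: is_derive1_comp; last exact: is_derive_sq_dif.
  by apply: dphi; rewrite g0; apply: sz; rewrite -val_eqE ltn_eqF.
have dh : is_derive (0 : R) 1 h (dot (dif w i j) (dif v i j)) by exact: is_derive_dot_dif.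
have := is_deriveM (is_deriveZ 2 dg) dh.
move=> H; apply: (is_derive_eq H).
rewrite /= h0 g0 /GRing.scale /= /GRing.scale /=.
by rewrite [dot (dif w i j) _]dotC; ring.
Qed.

(** [grad] and [Dgrad] record derivatives along basis vectors only; linearity supplies the other
    directions. *)
Lemma linear_form_delta (f : 'cV[R]_8 -> R) v :
  (forall c y y', f (c *: y + y') = c * f y + f y') ->
  f v = \sum_p v p 0 * f (delta_mx p 0).
Proof.
move=> fl.
have f0 : f 0 = 0.
  by have := fl 1 0 0; rewrite scale1r addr0 mul1r => /eqP;
     rewrite addrC -subr_eq subrr eq_sym => /eqP.
rewrite {1}[v]matrix_sum_delta.
rewrite (big_morph f (op1 := +%R) (id1 := 0)) // => [|y y'].
  by apply: eq_bigr => p _; rewrite big_ord1 -[_ *: _]addr0 fl f0 addr0.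
by rewrite -[y in LHS]scale1r fl mul1r.
Qed.

Lemma difZD c v w i j : dif (c *: v + w) i j = c *: dif v i j + dif w i j.
Proof. by apply/matrixP => k l; rewrite /dif !mxE; ring. Qed.

Lemma dotZD c (y z t : 'cV[R]_2) : dot y (c *: z + t) = c * dot y z + dot y t.
Proof. by rewrite !dotE !mxE; ring. Qed.

Lemma pair_grad_linear m z c v w :
  pair_grad phi m z (c *: v + w) = c * pair_grad phi m z v + pair_grad phi m z w.
Proof.
rewrite /pair_grad mulr_sumr -big_split; apply: eq_bigr => i _ /=.
rewrite mulr_sumr -big_split; apply: eq_bigr => j _ /=.
by rewrite difZD dotZD; ring.
Qed.

Lemma pair_hess_linear m z y c v w :
  pair_hess phi chi m z y (c *: v + w) =
  c * pair_hess phi chi m z y v + pair_hess phi chi m z y w.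
Proof.
rewrite /pair_hess mulr_sumr -big_split; apply: eq_bigr => i _ /=.
rewrite mulr_sumr -big_split; apply: eq_bigr => j _ /=.
by rewrite difZD !dotZD; ring.
Qed.

Lemma pair_hessC m z v w : pair_hess phi chi m z v w = pair_hess phi chi m z w v.
Proof.
apply: eq_bigr => i _; apply: eq_bigr => j _.
by rewrite (dotC (dif v i j)); ring.
Qed.

Lemma grad_pair_potential m z v : pairwise_separated z ->
  (v^T *m grad (pair_potential Phi m) z) 0 0 = pair_grad phi m z v.
Proof.
move=> sz; rewrite (linear_form_delta v (pair_grad_linear m z)) mxE.
by apply: eq_bigr => p _; rewrite !mxE derive_pair_potential.
Qed.

Lemma Dgrad_pair_potential m z v w : pairwise_separated z ->
  bil (Dgrad (pair_potential Phi m) z) v w = pair_hess phi chi m z v w.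
Proof.
move=> sz; rewrite pair_hessC (linear_form_delta v (pair_hess_linear m z w)) bilE.
apply: eq_bigr => p _; rewrite pair_hessC.
rewrite (linear_form_delta w (pair_hess_linear m z _)) mulr_sumr.
apply: eq_bigr => q _; rewrite -mulrA; congr (_ * _); rewrite mulrC; congr (_ * _).
rewrite mxE -derive_pair_grad // !derive_line.
(* The entries of the gradient are known to agree with [pair_grad] near [z] only, which determines
   their derivatives. *)
apply: near_eq_derive.
apply: (@filterS _ _ (nbhs_filter (0 : R)) _ _ _
  (near_pairwise_separated (delta_mx q 0) sz)) => t st.
by rewrite mxE derive_pair_potential.
Qed.

End Smooth.

End Potential.

(** * Frames of a half of the space of fields *)

Section Halves.
Variable R : realType.
Implicit Types (x v w : 'cV[R]_8) (m : 'I_4 -> R) (D : 'M[R]_8).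

Definition pair2 (T : Type) (s t : T) (i : 'I_2) : T := if i == 0 then s else t.

Lemma Minner_self_J m v : Minner m v (Jmx *m v) = 0.
Proof. by rewrite Minner_sum big1 // => i _; rewrite !dotE !ptJ; ring. Qed.

(** The fields [f0], [J f0], [f1], [J f1] are orthogonal for both [M] and [D], so the eigenvalues
    are Rayleigh quotients; [f] and [J f] have the same [M]-norm. *)
Lemma diag_half m D f0 f1 : D^T = D ->
  Minner m f0 f1 = 0 -> Minner m f0 (Jmx *m f1) = 0 ->
  Minner m f0 f0 != 0 -> Minner m f1 f1 != 0 ->
  bil D f0 f1 = 0 -> bil D f0 (Jmx *m f1) = 0 ->
  bil D (Jmx *m f0) f1 = 0 -> bil D (Jmx *m f0) (Jmx *m f1) = 0 ->
  bil D f0 (Jmx *m f0) = 0 -> bil D f1 (Jmx *m f1) = 0 ->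
  exists n a b : 'I_2 -> R, [/\ forall i, n i != 0,
    dual_frames m n (pair2 f0 f1) (pair2 f0 f1) &
    forall i j, diag_pair D n a b (pair2 f0 f1) (pair2 f0 f1) i j].
Proof.
move=> Dt e1 e2 n0 n1 b1 b2 b3 b4 b5 b6.
have bC := bilC _ _ Dt.
exists (pair2 (Minner m f0 f0) (Minner m f1 f1)).
exists (pair2 (bil D (Jmx *m f0) (Jmx *m f0) / Minner m f0 f0)
              (bil D (Jmx *m f1) (Jmx *m f1) / Minner m f1 f1)).
exists (pair2 (bil D f0 f0 / Minner m f0 f0) (bil D f1 f1 / Minner m f1 f1)).
split.
- by apply: ord2P.
- apply: ord2P; apply: ord2P; rewrite /pair2 /= ?Minner_self_J //; split=> //.
    by rewrite MinnerC.
  by rewrite -[LHS]opprK -MinnerJl MinnerC e2 oppr0.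
- apply: ord2P; apply: ord2P; rewrite /pair2 /=; split => //.
  + by rewrite mulrCA divff ?mulr1.
  + by rewrite mulrCA divff ?mulr1.
  + by rewrite bC.
  + by rewrite bC.
  + by rewrite bC.
  + by rewrite bC.
  + by rewrite bC.
  + by rewrite mulrCA divff ?mulr1.
  + by rewrite mulrCA divff ?mulr1.
  + by rewrite bC.
Qed.

(* When [f0] is isotropic, the frame dual to [(f0, f1)] is [(f1, f0)]. *)
Lemma swap_half m D f0 f1 (mu nu : R) : D^T = D ->
  Minner m f0 f0 = 0 -> Minner m f1 f1 = 0 ->
  Minner m f0 f1 != 0 -> Minner m f0 (Jmx *m f1) = 0 ->
  (forall w, bil D f0 w = mu * Minner m f0 w) ->
  (forall w, bil D (Jmx *m f0) w = nu * Minner m (Jmx *m f0) w) ->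
  [/\ dual_frames m (fun _ : 'I_2 => Minner m f0 f1) (pair2 f1 f0) (pair2 f0 f1) &
    forall i j : 'I_2, (j <= i)%N -> diag_pair D (fun=> Minner m f0 f1) (fun=> nu) (fun=> mu)
      (pair2 f1 f0) (pair2 f0 f1) i j].
Proof.
move=> Dt e0 e1 n0 e2 b1 b2.
have bC := bilC _ _ Dt.
have e3 : Minner m f1 (Jmx *m f0) = 0 by rewrite -[LHS]opprK -MinnerJl MinnerC e2 oppr0.
split.
  apply: ord2P; apply: ord2P; rewrite /pair2 /= ?Minner_self_J //; split=> //.
  by rewrite MinnerC.
apply: ord2P; apply: ord2P => // _; rewrite /pair2 /=; split;
  rewrite ?b1 ?b2 1?bC ?b1 ?b2 ?MinnerJ ?MinnerJl ?Minner_self_J ?e0 ?e1 ?e2 ?e3 ?oppr0 ?mulr0 //.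
- by rewrite mulrC.
- by rewrite mulrC.
- by rewrite mulrC.
- by rewrite mulrC.
Qed.

(** On the span of [w] and [J w] the form [D] is a symmetric 2 by 2 matrix on which [J] acts as a
    quarter turn; [v] and [J v] are its principal axes. *)
Lemma rotate_orthogonal D w : D^T = D -> exists c s : R, c ^+ 2 + s ^+ 2 != 0 /\
  bil D (c *: w + s *: (Jmx *m w)) (Jmx *m (c *: w + s *: (Jmx *m w))) = 0.
Proof.
move=> Dt.
set al := bil D w w; set be := bil D w (Jmx *m w); set de := bil D (Jmx *m w) (Jmx *m w).
have E c s : bil D (c *: w + s *: (Jmx *m w)) (Jmx *m (c *: w + s *: (Jmx *m w))) =
    c * s * (de - al) + (c ^+ 2 - s ^+ 2) * be.
  rewrite mulmxDr -!scalemxAr JmxJ !(bilDl, bilDr, bilZl, bilZr, bilNr).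
  by rewrite (bilC (Jmx *m w) w Dt) -/al -/be -/de; ring.
have [be0|be0] := eqVneq be 0.
  by exists 1, 0; rewrite E be0; split; [rewrite expr0n addr0 expr1n oner_neq0|ring].
(* With [s = 2 be] the entry to be killed is [be (c^2 + 2 d c - 4 be^2)], and [c = r - d] is a
   root. *)
pose d := de - al; pose r := Num.sqrt (d ^+ 2 + 4 * be ^+ 2).
have r2 : r ^+ 2 = d ^+ 2 + 4 * be ^+ 2.
  by rewrite sqr_sqrtr // addr_ge0 ?sqr_ge0 // mulr_ge0 ?sqr_ge0.
exists (r - d), (2 * be); split; last first.
  rewrite E -/d (_ : _ + _ = be * (r ^+ 2 - (d ^+ 2 + 4 * be ^+ 2))); last by ring.
  by rewrite r2 subrr mulr0.
rewrite gt_eqF // ltr_wpDl ?sqr_ge0 // exprn_even_gt0 //=.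
by rewrite mulf_neq0 // pnatr_eq0.
Qed.

Lemma Minner_Zl m c v w : Minner m (c *: v) w = c * Minner m v w.
Proof. exact: bilZl. Qed.

Lemma Minner_Dl m v v' w : Minner m (v + v') w = Minner m v w + Minner m v' w.
Proof. exact: bilDl. Qed.

Lemma Minner_rotate m c s w :
  Minner m (c *: w + s *: (Jmx *m w)) (c *: w + s *: (Jmx *m w)) =
  (c ^+ 2 + s ^+ 2) * Minner m w w.
Proof.
rewrite Minner_Dl !Minner_Zl ![Minner m _ (_ + _)]MinnerC !Minner_Dl !Minner_Zl.
by rewrite MinnerJ MinnerJl Minner_self_J; ring.
Qed.

Definition vec2 (al be : 'I_4 -> R) : 'cV[R]_8 :=
  \col_p (if odd p then be else al) (inord p./2).

Lemma vec2E al be i : (pt (vec2 al be) i 0 0 = al i) * (pt (vec2 al be) i 1 0 = be i).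
Proof.
by split; rewrite ptE mxE inord_idx_half val_idx oddD odd_double.
Qed.

Notation lo := (@lshift 2 2).
Notation hi := (@rshift 2 2).

Lemma eq_lo (a b : 'I_2) : ((lo a : 'I_4) == lo b) = (a == b).
Proof. exact: (inj_eq (@lshift_inj 2 2)). Qed.

Lemma eq_hi (a b : 'I_2) : ((hi a : 'I_4) == hi b) = (a == b).
Proof. exact: (inj_eq (@rshift_inj 2 2)). Qed.

Lemma eq_lohi (a b : 'I_2) : ((lo a : 'I_4) == hi b) = false.
Proof. exact: (@eq_lrshift 2 2). Qed.

Lemma eq_hilo (a b : 'I_2) : ((hi a : 'I_4) == lo b) = false.
Proof. exact: (@eq_rlshift 2 2). Qed.

(** In the application the low labels index the even half and the high labels the odd half. *)
Definition join4 (T : Type) (f g : 'I_2 -> T) (i : 'I_4) : T :=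
  match @fintype.split 2 2 i with inl a => f a | inr b => g b end.

Lemma join4_lshift (T : Type) (f g : 'I_2 -> T) a : join4 f g (lo a : 'I_4) = f a.
Proof. by rewrite /join4 (unsplitK (inl a)). Qed.

Lemma join4_rshift (T : Type) (f g : 'I_2 -> T) b : join4 f g (hi b : 'I_4) = g b.
Proof. by rewrite /join4 (unsplitK (inr b)). Qed.

Lemma join4P (P : 'I_4 -> Prop) :
  (forall a, P (lo a)) -> (forall b, P (hi b)) -> forall i, P i.
Proof.
move=> hl hr i; have := @splitK 2 2 i.
by case: (@fintype.split 2 2 i) => k /= <-.
Qed.

Definition join4E := (join4_lshift, join4_rshift).

Lemma join4_dual_frames m n n' g g' f f' :
  dual_frames m n g f -> dual_frames m n' g' f' ->
  (forall i j, Minner m (g i) (f' j) = 0 /\ Minner m (g i) (Jmx *m f' j) = 0) ->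
  (forall i j, Minner m (g' i) (f j) = 0 /\ Minner m (g' i) (Jmx *m f j) = 0) ->
  dual_frames m (join4 n n') (join4 g g') (join4 f f').
Proof.
move=> h h' hx hx'; apply: join4P => i; apply: join4P => j; rewrite !join4E.
- by rewrite eq_lo; apply: h.
- by rewrite eq_lohi; apply: hx.
- by rewrite eq_hilo; apply: hx'.
- by rewrite eq_hi; apply: h'.
Qed.

(** The relation [P] covers both uses: all pairs, or only those with [j <= i]. *)
Lemma join4_diag_pair D n n' a a' b b' g g' f f' (P : rel 'I_4) :
  (forall i j : 'I_2, P (lo i) (lo j) -> diag_pair D n a b g f i j) ->
  (forall i j : 'I_2, P (hi i) (hi j) -> diag_pair D n' a' b' g' f' i j) ->
  (forall i j, P (lo i) (hi j) ->
     [/\ bil D (g i) (f' j) = 0, bil D (Jmx *m g i) (Jmx *m f' j) = 0,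
         bil D (g i) (Jmx *m f' j) = 0 & bil D (Jmx *m g i) (f' j) = 0]) ->
  (forall i j, P (hi i) (lo j) ->
     [/\ bil D (g' i) (f j) = 0, bil D (Jmx *m g' i) (Jmx *m f j) = 0,
         bil D (g' i) (Jmx *m f j) = 0 & bil D (Jmx *m g' i) (f j) = 0]) ->
  forall i j, P i j ->
    diag_pair D (join4 n n') (join4 a a') (join4 b b') (join4 g g') (join4 f f') i j.
Proof.
move=> h h' hx hx'; apply: join4P => i; apply: join4P => j Pij; rewrite /diag_pair !join4E.
- by rewrite eq_lo; apply: h.
- by rewrite eq_lohi; apply: hx.
- by rewrite eq_hilo; apply: hx'.
- by rewrite eq_hi; apply: h'.
Qed.

End Halves.

(** * Centrally symmetric configurations *)

Section CentralSymmetry.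
Variable R : realType.
Implicit Types (x v w z : 'cV[R]_8).
Variables (m : 'I_4 -> R) (x : 'cV[R]_8) (rho : 'I_4 -> 'I_4).
Hypothesis m0 : forall i, m i != 0.
Hypothesis x_inj : injective (pt x).
Hypothesis xrho : forall i, pt x (rho i) = - pt x i.
Hypothesis mrho : forall i, m (rho i) = m i.

Definition even_field v := forall i, pt v (rho i) = pt v i.
Definition odd_field v := forall i, pt v (rho i) = - pt v i.

Lemma rhoK : involutive rho.
Proof. by move=> i; apply: x_inj; rewrite !xrho opprK. Qed.

Lemma even_fieldJ v : even_field v -> even_field (Jmx *m v).
Proof. by move=> ev i; rewrite !pt_blockdiag4 ev. Qed.

Lemma odd_fieldJ v : odd_field v -> odd_field (Jmx *m v).
Proof. by move=> ov i; rewrite !pt_blockdiag4 ov mulmxN. Qed.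

Lemma pt_lin c d v w i : pt (c *: v + d *: w) i = c *: pt v i + d *: pt w i.
Proof. by apply/matrixP => k l; rewrite !mxE. Qed.

Lemma even_field_lin c d v w : even_field v -> even_field w -> even_field (c *: v + d *: w).
Proof. by move=> ev ew i; rewrite !pt_lin ev ew. Qed.

Lemma odd_field_lin c d v w : odd_field v -> odd_field w -> odd_field (c *: v + d *: w).
Proof. by move=> ov ow i; rewrite !pt_lin ov ow !scalerN opprD. Qed.

Lemma eq_oppr_eq0 (a : R) : a = - a -> a = 0.
Proof. by move=> h; lra. Qed.

Lemma dotNN (y z : 'cV[R]_2) : dot (- y) (- z) = dot y z.
Proof. by rewrite !dotE !mxE; ring. Qed.

Lemma dotNr (y z : 'cV[R]_2) : dot y (- z) = - dot y z.
Proof. by rewrite !dotE !mxE; ring. Qed.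

(** Relabelling by [rho] changes the sign of every term, so the sum is its own opposite. *)
Lemma Minner_even_odd v w : even_field v -> odd_field w -> Minner m v w = 0.
Proof.
move=> ev ow; apply: eq_oppr_eq0.
rewrite {1}Minner_sum (reindex_inj (inv_inj rhoK)) /= Minner_sum -sumrN.
by apply: eq_bigr => i _; rewrite mrho ev ow dotNr mulrN.
Qed.

(** An involution of the labels need not respect their order, so a sum over [i < j] is turned into a
    full double sum before relabelling. *)
Lemma sum_lt_symmetric (f : 'I_4 -> 'I_4 -> R) :
  (forall i j, f i j = f j i) -> (forall i, f i i = 0) ->
  \sum_i \sum_j f i j = 2 * \sum_(i < 4) \sum_(j < 4 | (i < j)%N) f i j.
Proof.
move=> fC f0.
transitivity (\sum_(i < 4) (\sum_(j < 4 | (i < j)%N) f i j + \sum_(j < 4 | (j < i)%N) f i j)).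
  apply: eq_bigr => i _; rewrite (bigID (fun j : 'I_4 => (i < j)%N)) /=; congr (_ + _).
  rewrite (bigD1 i) ?ltnn //= f0 add0r; apply: eq_bigl => j.
  by rewrite -leqNgt ltn_neqAle andbC.
rewrite big_split /= mulr2n mulrDl mul1r; congr (_ + _).
rewrite (exchange_big_dep xpredT) //=; apply: eq_bigr => i _.
by apply: eq_bigr => j _; rewrite fC.
Qed.

Variables (phi chi : R -> R).

Lemma pair_hess_sum v w : 2 * pair_hess phi chi m x v w = \sum_i \sum_j
    m i * m j * (2 * phi (dot (dif x i j) (dif x i j)) * dot (dif v i j) (dif w i j) +
      4 * chi (dot (dif x i j) (dif x i j)) *
        (dot (dif x i j) (dif v i j) * dot (dif x i j) (dif w i j))).
Proof.
rewrite sum_lt_symmetric // => [i j|i].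
  have difC z : dif z j i = - dif z i j by rewrite /dif opprB.
  by rewrite !difC !dotNN; ring.
have -> z : dif z i i = 0 by rewrite /dif subrr.
by rewrite !dotE !mxE; ring.
Qed.

(** Under [rho] the differences of [x] and [w] change sign and those of [v] do not, so both terms of
    the Hessian change sign while the squared distances are invariant. *)
Lemma pair_hess_even_odd v w : even_field v -> odd_field w ->
  pair_hess phi chi m x v w = 0.
Proof.
move=> ev ow; apply: eq_oppr_eq0.
suff : 2 * pair_hess phi chi m x v w = - (2 * pair_hess phi chi m x v w) by move=> ?; lra.
rewrite {1}pair_hess_sum (reindex_inj (inv_inj rhoK)) /= pair_hess_sum -sumrN.
apply: eq_bigr => i _; rewrite (reindex_inj (inv_inj rhoK)) /= -sumrN.
apply: eq_bigr => j _; rewrite !mrho.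
have difo z : odd_field z -> dif z (rho i) (rho j) = - dif z i j.
  by move=> oz; rewrite /dif !oz opprB addrC opprK.
rewrite (difo _ xrho) (difo _ ow) /dif !ev -/(dif x i j) -/(dif v i j) -/(dif w i j).
rewrite !dotNN dotNr (dotC (- _)) dotNr (dotC _ (dif x i j)).
by ring.
Qed.

Lemma pair_hess_const v w : (forall i j, pt v i = pt v j) -> pair_hess phi chi m x v w = 0.
Proof.
move=> vc; apply: big1 => i _; apply: big1 => j _.
by rewrite (_ : dif v i j = 0) ?/dif ?(vc i j) ?subrr // !dotE !mxE; ring.
Qed.

Section Equilibrium.
Variables (gamma c : R).
Hypothesis x_sep : pairwise_separated x.
Hypothesis homog : forall s : R, 0 < s -> chi s * s = gamma * phi s.
Hypothesis equil : forall w, pair_grad phi m x w = c * Minner m w x.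

(** Euler's relation: the gradient is homogeneous of degree [1 + 2 gamma], so its derivative at [x]
    along [x] is [1 + 2 gamma] times the gradient [c M x]. *)
Lemma pair_hess_radial w : pair_hess phi chi m x x w = (1 + 2 * gamma) * c * Minner m x w.
Proof.
rewrite MinnerC -mulrA -equil /pair_grad mulr_sumr; apply: eq_bigr => i _.
rewrite mulr_sumr; apply: eq_bigr => j ij.
have sij : 0 < dot (dif x i j) (dif x i j) by apply: x_sep; rewrite -val_eqE ltn_eqF.
transitivity (m i * m j * (2 * phi (dot (dif x i j) (dif x i j)) * dot (dif x i j) (dif w i j) +
   4 * (chi (dot (dif x i j) (dif x i j)) * dot (dif x i j) (dif x i j)) *
     dot (dif x i j) (dif w i j))).
  by ring.
by rewrite homog //; ring.
Qed.

(** Infinitesimal rotation equivariance: the derivative of the gradient along [J x] is [J] applied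
    to the gradient, that is [c M J x]. *)
Lemma pair_hess_rotation w :
  pair_hess phi chi m x (Jmx *m x) w = c * Minner m (Jmx *m x) w.
Proof.
rewrite MinnerJl MinnerC mulrN -equil /pair_grad -sumrN; apply: eq_bigr => i _.
rewrite -sumrN; apply: eq_bigr => j ij.
have difJ z : (dif (Jmx *m z) i j 0 0 = - dif z i j 1 0) * (dif (Jmx *m z) i j 1 0 = dif z i j 0 0).
  by split; rewrite !difE -!ptE !ptJ; ring.
(* A vector is orthogonal to its quarter turn, so the [chi] term drops out. *)
have -> : dot (dif x i j) (dif (Jmx *m x) i j) = 0 by rewrite dotE !difJ; ring.
rewrite mul0r mulr0 addr0 -mulrN -mulrN; congr (_ * (_ * _)).
by rewrite !dotE !difJ; ring.
Qed.

End Equilibrium.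

(** * Frames of the even and odd halves, in the labels [i0], [rho i0], [i2], [rho i2] *)

Section Labels.
Variables (i0 i2 : 'I_4).
Hypothesis sum4 : forall f : 'I_4 -> R,
  \sum_i f i = f i0 + f (rho i0) + f i2 + f (rho i2).
Hypothesis all4 : forall P : 'I_4 -> Prop,
  P i0 -> P (rho i0) -> P i2 -> P (rho i2) -> forall i, P i.
Hypothesis r0 : (rho i0 == i0) = false.
Hypothesis r2 : (rho i2 == i2) = false.
Hypothesis i20 : (i2 == i0) = false.
Hypothesis i2r0 : (i2 == rho i0) = false.
Hypothesis r20 : (rho i2 == i0) = false.
Hypothesis r2r0 : (rho i2 == rho i0) = false.
Variable D : 'M[R]_8.
Hypothesis DE : forall v w, bil D v w = pair_hess phi chi m x v w.

Let m1 := m i0.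
Let m2 := m i2.

Definition pick4 (s s' t t' : R) (i : 'I_4) :=
  if i == i0 then s else if i == rho i0 then s' else if i == i2 then t else t'.

Lemma pick4E s s' t t' : (pick4 s s' t t' i0 = s) * (pick4 s s' t t' (rho i0) = s') *
  (pick4 s s' t t' i2 = t) * (pick4 s s' t t' (rho i2) = t').
Proof. by rewrite /pick4 !eqxx r0 r2 i20 i2r0 r20 r2r0. Qed.

Lemma bilDC v w : bil D v w = bil D w v.
Proof. by rewrite !DE pair_hessC. Qed.

Lemma D_sym : D^T = D.
Proof.
apply/matrixP => p q; rewrite mxE.
have e (i j : 'I_8) : bil D (delta_mx i 0) (delta_mx j 0) = D i j.
  by rewrite /bil trmx_delta -rowE -colE !mxE.
by rewrite -!e bilDC.
Qed.

(** [tri_half] serves the determinant, [diagonal_half] the eigenvectors. The values [a] and [b] are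
    parameters so that the factorization and the eigenbasis share them. *)
Definition tri_half (E : 'cV[R]_8 -> Prop) (a b : 'I_2 -> R) := exists n g f,
  [/\ forall i, n i != 0, forall i, E (g i) /\ E (f i), dual_frames m n g f &
      forall i j : 'I_2, (j <= i)%N -> diag_pair D n a b g f i j].

Definition diagonal_half (E : 'cV[R]_8 -> Prop) (a b : 'I_2 -> R) := exists n f,
  [/\ forall i, n i != 0, forall i, E (f i), dual_frames m n f f &
      forall i j : 'I_2, diag_pair D n a b f f i j].

Lemma diagonal_tri_half E a b : diagonal_half E a b -> tri_half E a b.
Proof. by case=> n [f [h1 h2 h3 h4]]; exists n, f, f; split. Qed.

Lemma total_massE : total_mass m = 2 * (m1 + m2).
Proof. by rewrite /total_mass sum4 !mrho /m1 /m2; ring. Qed.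

Lemma even_vec2 al be : (forall i, al (rho i) = al i) -> (forall i, be (rho i) = be i) ->
  even_field (vec2 al be).
Proof.
move=> ea eb i; apply/matrixP => k l; rewrite ord1.
by elim/ord2P: k; rewrite !vec2E ?ea ?eb.
Qed.

Lemma pick4_even s t i : pick4 s s t t (rho i) = pick4 s s t t i.
Proof. by elim/all4: i; rewrite ?rhoK !pick4E. Qed.

Lemma pick4_odd s t i : pick4 s (- s) t (- t) (rho i) = - pick4 s (- s) t (- t) i.
Proof. by elim/all4: i; rewrite ?rhoK !pick4E ?opprK. Qed.

Lemma odd_vec2 s t s' t' :
  odd_field (vec2 (pick4 s (- s) t (- t)) (pick4 s' (- s') t' (- t'))).
Proof.
move=> i; apply/matrixP => k l; rewrite ord1 [RHS]mxE.
by elim/ord2P: k; rewrite !vec2E pick4_odd.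
Qed.

Lemma even_half : exists a b : 'I_2 -> R,
  tri_half even_field a b /\ (total_mass m != 0 -> diagonal_half even_field a b).
Proof.
pose f0 := vec2 (fun=> 1 : R) (fun=> 0).
have ev0 : even_field f0 by apply: even_vec2.
have c0 i j : pt f0 i = pt f0 j.
  by apply/matrixP => k l; rewrite ord1; elim/ord2P: k; rewrite !vec2E.
have cJ0 i j : pt (Jmx *m f0) i = pt (Jmx *m f0) j by rewrite !pt_blockdiag4 (c0 i j).
have [tm|tm] := eqVneq (total_mass m) 0.
  (* With [m2 = - m1] this field is isotropic too, and it pairs with the translation [f0] to
     [4 m1]. *)
  pose f1 := vec2 (pick4 1 1 (- 1) (- 1)) (fun=> 0).
  have ev1 : even_field f1 by apply: even_vec2 => // i; exact: pick4_even.
  have m12 : m1 + m2 = 0 by move: tm; rewrite total_massE => tm; lra.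
  have e00 : Minner m f0 f0 = 0.
    by rewrite Minner_sum sum4 !dotE !vec2E !mrho -/m1 -/m2; lra.
  have e11 : Minner m f1 f1 = 0.
    by rewrite Minner_sum sum4 !dotE !vec2E !pick4E !mrho -/m1 -/m2; lra.
  have e01 : Minner m f0 f1 = 4 * m1.
    by rewrite Minner_sum sum4 !dotE !vec2E !pick4E !mrho -/m1 -/m2; lra.
  have eJ : Minner m f0 (Jmx *m f1) = 0.
    by rewrite Minner_sum sum4 !dotE !ptJ !vec2E !pick4E; ring.
  have n0 : Minner m f0 f1 != 0 by rewrite e01 mulf_neq0 ?pnatr_eq0 ?m0.
  have b0 w : bil D f0 w = 0 * Minner m f0 w by rewrite mul0r DE pair_hess_const.
  have b1 w : bil D (Jmx *m f0) w = 0 * Minner m (Jmx *m f0) w.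
    by rewrite mul0r DE pair_hess_const.
  have [h1 h2] := swap_half D_sym e00 e11 n0 eJ b0 b1.
  exists (fun=> 0), (fun=> 0); split=> //.
  exists (fun=> Minner m f0 f1), (pair2 f1 f0), (pair2 f0 f1); split => //.
  by apply: ord2P.
(* The mass-weighted sum of [w] vanishes, so [w] is [M]-orthogonal to both translations. *)
pose w := vec2 (pick4 m2 m2 (- m1) (- m1)) (fun=> 0).
have evw : even_field w by apply: even_vec2 => // i; exact: pick4_even.
have [c' [s [cs0 rot]]] := rotate_orthogonal w D_sym.
set f1 := c' *: w + s *: (Jmx *m w) in rot.
have ev1 : even_field f1 by apply: even_field_lin => //; exact: even_fieldJ.
have e0w : Minner m f0 w = 0.
  by rewrite Minner_sum sum4 !dotE !vec2E !pick4E !mrho -/m1 -/m2; ring.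
have e0Jw : Minner m f0 (Jmx *m w) = 0.
  by rewrite Minner_sum sum4 !dotE !ptJ !vec2E !pick4E; ring.
have eww : Minner m w w = m1 * m2 * total_mass m.
  by rewrite total_massE Minner_sum sum4 !dotE !vec2E !pick4E !mrho -/m1 -/m2; ring.
have e01 : Minner m f0 f1 = 0.
  by rewrite MinnerC Minner_Dl !Minner_Zl ![Minner m _ f0]MinnerC e0w e0Jw !mulr0 addr0.
have e0J1 : Minner m f0 (Jmx *m f1) = 0.
  rewrite mulmxDr -!scalemxAr JmxJ scalerN -scaleNr.
  by rewrite MinnerC Minner_Dl !Minner_Zl ![Minner m _ f0]MinnerC e0w e0Jw !mulr0 addr0.
have n0 : Minner m f0 f0 != 0.
  suff -> : Minner m f0 f0 = total_mass m by [].
  by rewrite total_massE Minner_sum sum4 !dotE !vec2E !mrho -/m1 -/m2; ring.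
have n1 : Minner m f1 f1 != 0 by rewrite Minner_rotate eww !mulf_neq0 ?m0.
have bz v' : bil D f0 v' = 0 by rewrite DE pair_hess_const.
have bzJ v' : bil D (Jmx *m f0) v' = 0 by rewrite DE pair_hess_const.
have [n [a [b [h1 h2 h3]]]] :=
  diag_half D_sym e01 e0J1 n0 n1 (bz _) (bz _) (bzJ _) (bzJ _) (bz _) rot.
have H : diagonal_half even_field a b.
  by exists n, (pair2 f0 f1); split=> //; apply: (@ord2P (fun i => even_field (pair2 f0 f1 i))).
by exists a, b; split=> [|_] //; exact: diagonal_tri_half.
Qed.

Lemma inertiaE : inertia m x = 2 * (m1 * (pt x i0 0 0 ^+ 2 + pt x i0 1 0 ^+ 2) +
  m2 * (pt x i2 0 0 ^+ 2 + pt x i2 1 0 ^+ 2)).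
Proof. by rewrite /inertia Minner_sum sum4 !dotE !xrho !mxE -!ptE !mrho -/m1 -/m2; ring. Qed.

(** The case where [D] is a multiple of [M] on odd fields comes first, because it gives a diagonal
    frame whether or not [x] is isotropic. *)
Lemma odd_half (mu nu : R) :
  (forall w, bil D x w = mu * Minner m x w) ->
  (forall w, bil D (Jmx *m x) w = nu * Minner m (Jmx *m x) w) ->
  exists a b : 'I_2 -> R, tri_half odd_field a b /\
  ((exists k, forall v w, odd_field v -> odd_field w -> bil D v w = k * Minner m v w) \/
    inertia m x != 0 -> diagonal_half odd_field a b).
Proof.
move=> Dx DJx; have oJ := odd_fieldJ.
have [[k flat]|nflat] := pselect (exists k, forall v w, odd_field v -> odd_field w ->
    bil D v w = k * Minner m v w).
  (* Unit fields, each supported on one antipodal pair; the entries [- 0] match the shape in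
     [odd_vec2]. *)
  pose f0 := vec2 (pick4 1 (- 1) 0 (- 0)) (pick4 0 (- 0) 0 (- 0)).
  pose f1 := vec2 (pick4 0 (- 0) 1 (- 1)) (pick4 0 (- 0) 0 (- 0)).
  have o0 : odd_field f0 by exact: odd_vec2.
  have o1 : odd_field f1 by exact: odd_vec2.
  have e01 : Minner m f0 f1 = 0.
    by rewrite Minner_sum sum4 !dotE !vec2E !pick4E; ring.
  have eJ : Minner m f0 (Jmx *m f1) = 0.
    by rewrite Minner_sum sum4 !dotE !ptJ !vec2E !pick4E; ring.
  have e00 : Minner m f0 f0 = 2 * m1.
    by rewrite Minner_sum sum4 !dotE !vec2E !pick4E !mrho -/m1 -/m2; ring.
  have e11 : Minner m f1 f1 = 2 * m2.
    by rewrite Minner_sum sum4 !dotE !vec2E !pick4E !mrho -/m1 -/m2; ring.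
  have n0 : Minner m f0 f0 != 0 by rewrite e00 mulf_neq0 ?pnatr_eq0 ?m0.
  have n1 : Minner m f1 f1 != 0 by rewrite e11 mulf_neq0 ?pnatr_eq0 ?m0.
  have [|||||| n [a [b [h1 h2 h3]]]] := diag_half D_sym e01 eJ n0 n1;
    try by rewrite flat ?MinnerJ ?MinnerJl ?Minner_self_J ?e01 ?eJ ?oppr0 ?mulr0 //; auto.
  have H : diagonal_half odd_field a b.
    by exists n, (pair2 f0 f1); split=> //; apply: (@ord2P (fun i => odd_field (pair2 f0 f1 i))).
  by exists a, b; split=> [|_] //; exact: diagonal_tri_half.
have [I0|I0] := eqVneq (inertia m x) 0.
  pose p := pt x i0; pose q := pt x i2.
  (* [f1] is [x] with the second antipodal pair reversed. Zero inertia makes the contributions of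
     the two pairs opposite, so [f1] is isotropic and pairs with [x] to [4 m1 |p|^2]. *)
  pose f1 := vec2 (pick4 (p 0 0) (- p 0 0) (- q 0 0) (- - q 0 0))
                  (pick4 (p 1 0) (- p 1 0) (- q 1 0) (- - q 1 0)).
  have o1 : odd_field f1 by exact: odd_vec2.
  have pq : m1 * (p 0 0 ^+ 2 + p 1 0 ^+ 2) + m2 * (q 0 0 ^+ 2 + q 1 0 ^+ 2) = 0.
    by move: I0; rewrite inertiaE -/p -/q => ?; lra.
  have xr i k : pt x (rho i) k 0 = - pt x i k 0 by rewrite xrho mxE.
  have e11 : Minner m f1 f1 = 0.
    by rewrite Minner_sum sum4 !dotE !vec2E !pick4E !mrho -/m1 -/m2; lra.
  have e01 : Minner m x f1 = 4 * m1 * (p 0 0 ^+ 2 + p 1 0 ^+ 2).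
    rewrite Minner_sum sum4 !dotE !vec2E !pick4E !mrho !xr -/p -/q -/m1 -/m2; lra.
  have eJ : Minner m x (Jmx *m f1) = 0.
    by rewrite Minner_sum sum4 !dotE !ptJ !vec2E !pick4E !mrho !xr -/p -/q -/m1 -/m2; ring.
  (* A point at the origin would be its own antipode, forcing [rho i0 = i0]. *)
  have p0 : p 0 0 ^+ 2 + p 1 0 ^+ 2 != 0.
    rewrite paddr_eq0 ?sqr_ge0 // !sqrf_eq0; apply/negP => /andP[/eqP p0 /eqP p1].
    suff : rho i0 == i0 by rewrite r0.
    rewrite -(inj_eq x_inj); apply/eqP/matrixP => k l; rewrite ord1 xr -/p.
    by elim/ord2P: k; rewrite ?p0 ?p1 oppr0.
  have n0 : Minner m x f1 != 0 by rewrite e01 !mulf_neq0 ?pnatr_eq0 ?m0.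
  have [h1 h2] := swap_half D_sym I0 e11 n0 eJ Dx DJx.
  exists (fun=> nu), (fun=> mu); split; last by case.
  exists (fun=> Minner m x f1), (pair2 f1 x), (pair2 x f1); split => //.
  by apply: ord2P.
pose p := pt x i0; pose q := pt x i2.
(* Because of the conjugates, the two pairs contribute opposite multiples of [m1 m2 p q] to the
   Hermitian product with [x]; its vanishing gives orthogonality to [w] and [J w] together. *)
pose w := vec2 (pick4 (m2 * q 0 0) (- (m2 * q 0 0)) (- (m1 * p 0 0)) (- - (m1 * p 0 0)))
               (pick4 (- (m2 * q 1 0)) (- - (m2 * q 1 0)) (m1 * p 1 0) (- (m1 * p 1 0))).
have ow : odd_field w by exact: odd_vec2.
have xr i k : pt x (rho i) k 0 = - pt x i k 0 by rewrite xrho mxE.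
have [c' [s [cs0 rot]]] := rotate_orthogonal w D_sym.
set f1 := c' *: w + s *: (Jmx *m w) in rot.
have o1 : odd_field f1 by apply: odd_field_lin => //; exact: odd_fieldJ.
have e0w : Minner m x w = 0.
  by rewrite Minner_sum sum4 !dotE !vec2E !pick4E !mrho !xr -/p -/q -/m1 -/m2; ring.
have e0Jw : Minner m x (Jmx *m w) = 0.
  by rewrite Minner_sum sum4 !dotE !ptJ !vec2E !pick4E !mrho !xr -/p -/q -/m1 -/m2; ring.
have eww : Minner m w w = m1 * m2 * inertia m x.
  by rewrite inertiaE Minner_sum sum4 !dotE !vec2E !pick4E !mrho -/p -/q -/m1 -/m2; ring.
have e01 : Minner m x f1 = 0.
  by rewrite MinnerC Minner_Dl !Minner_Zl ![Minner m _ x]MinnerC e0w e0Jw !mulr0 addr0.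
have e0J1 : Minner m x (Jmx *m f1) = 0.
  rewrite mulmxDr -!scalemxAr JmxJ scalerN -scaleNr.
  by rewrite MinnerC Minner_Dl !Minner_Zl ![Minner m _ x]MinnerC e0w e0Jw !mulr0 addr0.
have n1 : Minner m f1 f1 != 0 by rewrite Minner_rotate eww !mulf_neq0 ?m0.
have [|||||n [a [b [h1 h2 h3]]]] := diag_half D_sym e01 e0J1 I0 n1 _ _ _ _ _ rot;
  try by rewrite ?Dx ?DJx ?MinnerJ ?MinnerJl ?Minner_self_J ?e01 ?e0J1 ?oppr0 ?mulr0.
have H : diagonal_half odd_field a b.
  by exists n, (pair2 x f1); split=> //; apply: (@ord2P (fun i => odd_field (pair2 x f1 i))).
by exists a, b; split=> [|_] //; exact: diagonal_tri_half.
Qed.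

Lemma bil_even_odd v w : even_field v -> odd_field w ->
  [/\ bil D v w = 0, bil D (Jmx *m v) (Jmx *m w) = 0,
      bil D v (Jmx *m w) = 0 & bil D (Jmx *m v) w = 0].
Proof.
move=> ev ow; have eJ := even_fieldJ ev; have oJ := odd_fieldJ ow.
by rewrite !DE; split; exact: pair_hess_even_odd.
Qed.

Lemma bil_odd_even v w : odd_field v -> even_field w ->
  [/\ bil D v w = 0, bil D (Jmx *m v) (Jmx *m w) = 0,
      bil D v (Jmx *m w) = 0 & bil D (Jmx *m v) w = 0].
Proof.
move=> ov ew; have [] := bil_even_odd ew ov.
by rewrite ![bil D w _]bilDC ![bil D (_ *m w) _]bilDC.
Qed.

Lemma Minner_even_odd_J v w : even_field v -> odd_field w ->
  Minner m v w = 0 /\ Minner m v (Jmx *m w) = 0.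
Proof. by move=> ev ow; split; apply: Minner_even_odd => //; exact: odd_fieldJ. Qed.

Lemma Minner_odd_even_J v w : odd_field v -> even_field w ->
  Minner m v w = 0 /\ Minner m v (Jmx *m w) = 0.
Proof.
by move=> ov ew; split; rewrite MinnerC; apply: Minner_even_odd => //; exact: even_fieldJ.
Qed.

(** For [phi = 1/2] the Hessian is the total mass times [M], minus the scalar product of the
    mass-weighted sums of [v] and [w]; those sums vanish for odd fields. *)
Lemma flat_form : pairwise_separated x ->
  (forall s : R, 0 < s -> phi s = 2^-1) -> (forall s : R, 0 < s -> chi s = 0) ->
  forall v w, odd_field v -> odd_field w -> bil D v w = total_mass m * Minner m v w.
Proof.
move=> xs phi1 chi0 v w ov ow; apply: (@mulfI _ 2); rewrite ?pnatr_eq0 // DE pair_hess_sum.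
transitivity (\sum_i \sum_j m i * m j * dot (dif v i j) (dif w i j)).
  apply: eq_bigr => i _; apply: eq_bigr => j _; have [->|ij] := eqVneq i j.
    by rewrite /dif !subrr !dotE !mxE; ring.
  by rewrite phi1 ?chi0 ?xs // mulfV ?pnatr_eq0 // mul1r mulr0 mul0r addr0.
have ovE k i : pt v (rho i) k 0 = - pt v i k 0 by rewrite ov mxE.
have owE k i : pt w (rho i) k 0 = - pt w i k 0 by rewrite ow mxE.
have difpt z i j k : dif z i j k 0 = pt z i k 0 - pt z j k 0 by rewrite difE !ptE.
rewrite total_massE Minner_sum !sum4 !dotE !difpt !ovE !owE !mrho -/m1 -/m2.
by ring.
Qed.

Lemma central_factorization (mu nu : R) :
  (forall w, bil D x w = mu * Minner m x w) ->
  (forall w, bil D (Jmx *m x) w = nu * Minner m (Jmx *m x) w) ->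
  exists a b : 'I_4 -> R,
  (forall c y : {poly R},
    \det (map_mx polyC (invmx (massmx m) *m D) + c%:M + y *: Jmx) =
    \prod_i \det (skew_block ((a i)%:P + c) ((b i)%:P + c) y)) /\
  (total_mass m != 0 ->
   (exists k, forall v w, odd_field v -> odd_field w -> bil D v w = k * Minner m v w) \/
     inertia m x != 0 ->
   exists v : 'I_4 -> 'cV[R]_8, splits_A (invmx (massmx m) *m D) m a b v).
Proof.
move=> Dx DJx.
have [a [b [T H]]] := even_half.
have [a' [b' [T' H']]] := odd_half Dx DJx.
exists (join4 a a'), (join4 b b'); split => [c y|].
  have [n [g [f [n0 E dF tF]]]] := T.
  have [n' [g' [f' [n0' E' dF' tF']]]] := T'.
  apply: (triangular_pencil (n := join4 n n') (g := join4 g g') (f := join4 f f')) => //.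
  - by apply: join4P => i; rewrite !join4E.
  - apply: join4_dual_frames => // i j.
      by apply: Minner_even_odd_J; [case: (E i)|case: (E' j)].
    by apply: Minner_odd_even_J; [case: (E' i)|case: (E j)].
  (* The order of ['I_4] restricts to the order of each half, and the blocks between the halves
     vanish. *)
  - apply: (join4_diag_pair (P := fun i j => (j <= i)%N)) => i j ij.
    + exact: tF.
    + by apply: tF'; move: ij; rewrite /= leq_add2l.
    + by apply: bil_even_odd; [case: (E i)|case: (E' j)].
    + by apply: bil_odd_even; [case: (E' i)|case: (E j)].
move=> /H[n [f [n0 E dF tF]]] /H'[n' [f' [n0' E' dF' tF']]].
exists (join4 f f'); apply: (diagonal_splits (n := join4 n n')) => //.
- by apply: join4P => i; rewrite !join4E.
- apply: join4_dual_frames => // i j; first exact: Minner_even_odd_J.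
  exact: Minner_odd_even_J.
- move=> i j; apply: (join4_diag_pair (P := fun _ _ => true)) => // {}i {}j _.
    exact: bil_even_odd.
  exact: bil_odd_even.
Qed.

End Labels.

End CentralSymmetry.

(** * Labels and shape of a D2-symmetric configuration *)

Lemma exists_notin (s : seq 'I_4) : (size s < 4)%N -> exists i, i \notin s.
Proof.
move=> s4; have [h|] := boolP [forall i, i \in s]; last first.
  by rewrite negb_forall => /existsP[i]; exists i.
have := @uniq_leq_size _ (enum 'I_4) s (enum_uniq _); rewrite size_enum_ord leqNgt s4.
have hs : {subset enum 'I_4 <= s} by move=> i _; apply: (forallP h).
by move=> /(_ hs).
Qed.

Lemma uniq_size_ord4 (s : seq 'I_4) : uniq s -> (size s <= 4)%N.
Proof.
move=> us; have := @uniq_leq_size _ s (enum 'I_4) us; rewrite size_enum_ord.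
by apply=> i _; rewrite mem_enum.
Qed.

Lemma perm_of_uniq (i0 i1 i2 i3 : 'I_4) : uniq [:: i0; i1; i2; i3] ->
  exists s : {perm 'I_4}, [/\ s 0 = i0, s 1 = i1, s 2 = i2 & s 3 = i3].
Proof.
move=> u; pose f (k : 'I_4) := nth i0 [:: i0; i1; i2; i3] k.
have fi : injective f.
  by move=> j k /eqP; rewrite nth_uniq // => /eqP /val_inj.
by exists (perm fi); rewrite !permE.
Qed.

(* A fixed point of [rho] would leave three labels to be paired off by [rho]. *)
Lemma central_labels (rho : 'I_4 -> 'I_4) :
  involutive rho -> (forall i j, rho i = i -> rho j = j -> i = j) ->
  exists s : {perm 'I_4}, s 2 = rho (s 0) /\ s 3 = rho (s 1).
Proof.
move=> rhoK fix1.
have rhoI := inv_inj rhoK.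
have rhoN i : (rho i == i) = false.
  apply/eqP => ri.
  have [j] : exists j, j \notin [:: i] by apply: exists_notin.
  rewrite inE => ji.
  have rjj : (rho j == j) = false.
    by apply/eqP => rj; move: ji; rewrite (fix1 _ _ rj ri) eqxx.
  have rji : (rho j == i) = false by rewrite -{1}ri (inj_eq rhoI) (negPf ji).
  have [l] : exists l, l \notin [:: i; j; rho j] by apply: exists_notin.
  rewrite !inE !negb_or => /and3P[li lj lrj].
  have rll : (rho l == l) = false.
    by apply/eqP => rl; move: li; rewrite (fix1 _ _ rl ri) eqxx.
  have rli : (rho l == i) = false by rewrite -{1}ri (inj_eq rhoI) (negPf li).
  have rlj : (rho l == j) = false by rewrite -(inj_eq rhoI) rhoK (negPf lrj).
  have := @uniq_size_ord4 [:: i; j; rho j; l; rho l].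
  rewrite /= !inE !negb_or (eq_sym i) ji (eq_sym i) rji (eq_sym i) li (eq_sym i) rli.
  rewrite (eq_sym j) rjj (eq_sym j) lj (eq_sym j) rlj (eq_sym (rho j)) lrj.
  by rewrite (inj_eq rhoI) (eq_sym j) lj (eq_sym l) rll => /(_ isT).
have [j] : exists j, j \notin [:: 0; rho 0] by apply: exists_notin.
rewrite !inE !negb_or => /andP[j0 jr0].
(* Antipodal labels get positions differing by 2, so that [s] runs around the quadrilateral. *)
have [|s [s0 s1 s2 s3]] := @perm_of_uniq 0 j (rho 0) (rho j).
  rewrite /= !inE !negb_or (eq_sym 0) j0 (eq_sym 0) rhoN jr0 (eq_sym j) rhoN.
  by rewrite (inj_eq rhoI) (eq_sym 0 j) j0 -(inj_eq rhoI) rhoK (eq_sym _ j) jr0.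
by exists s; rewrite s0 s1 s2 s3.
Qed.

Lemma sum_perm4 (V : nmodType) (s : {perm 'I_4}) (f : 'I_4 -> V) :
  \sum_i f i = f (s 0) + (f (s 1) + (f (s 2) + f (s 3))).
Proof.
rewrite (reindex_inj (@perm_inj _ s)) /= !big_ord_recl big_ord0 addr0.
by congr (f (s _) + (f (s _) + (f (s _) + f (s _)))); apply: val_inj.
Qed.

Lemma perm4P (s : {perm 'I_4}) (P : 'I_4 -> Prop) :
  P (s 0) -> P (s 1) -> P (s 2) -> P (s 3) -> forall i, P i.
Proof. by move=> h0 h1 h2 h3 i; rewrite -(permKV s i); elim/ord4P: (_ i). Qed.

(** * Collinear points, rhombus or rectangle *)

Section Trichotomy.
Variable R : realType.
Variables (u : 'cV[R]_2) (x : 'cV[R]_8) (s : {perm 'I_4}).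
Hypothesis u_unit : enorm u = 1.
Hypothesis x2 : pt x (s 2) = - pt x (s 0).
Hypothesis x3 : pt x (s 3) = - pt x (s 1).
Hypothesis x_refl : forall i, exists j, reflection u *m pt x i = pt x j.

(** The points are [p], [q], [- p], [- q]. If the reflection sends one of [p], [q] to plus or minus
    the other, their norms agree and the figure is a rectangle; otherwise each lies on the mirror or
    on its perpendicular. *)
Lemma central_trichotomy :
  collinear_points x \/ rhombus_vertices x \/ rectangle_vertices x.
Proof.
set p := pt x (s 0); set q := pt x (s 1).
have p2 : pt x (s 2) = - p by [].
have q3 : pt x (s 3) = - q by [].
pose a := u 0 0; pose b := u 1 0.
have ab1 : a * a + b * b = 1.
  rewrite -(expr1n _ 2) -u_unit sqr_sqrtr dotE // addr_ge0 // -expr2 sqr_ge0 //.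
have ptP (P : 'cV[R]_2 -> Prop) : P p -> P (- p) -> P q -> P (- q) -> forall i, P (pt x i).
  by move=> h1 h2 h3 h4; apply: (perm4P (s := s)); rewrite ?p2 ?q3.
(* Orthonormal coordinates along and across the mirror; the reflection fixes [dt] and negates
   [cr]. *)
pose dt (y : 'cV[R]_2) := a * y 0 0 + b * y 1 0.
pose cr (y : 'cV[R]_2) := a * y 1 0 - b * y 0 0.
have dotdc y z : dot y z = dt y * dt z + cr y * cr z.
  transitivity ((a * a + b * b) * dot y z); first by rewrite ab1 mul1r.
  by rewrite dotE /dt /cr; ring.
have reflE y : ((reflection u *m y) 0 0 = 2 * dt y * a - y 0 0) *
               ((reflection u *m y) 1 0 = 2 * dt y * b - y 1 0).
  by split; rewrite !mxE sum_ord2 !mxE !big_ord1 !mxE -/a -/b /dt /=; ring.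
have dtr y : dt (reflection u *m y) = dt y.
  transitivity (2 * dt y * (a * a + b * b) - dt y); last by rewrite ab1; ring.
  by rewrite {1}/dt !reflE /dt; ring.
have crr y : cr (reflection u *m y) = - cr y.
  by rewrite /cr !reflE; ring.
have dtN y : dt (- y) = - dt y by rewrite /dt !mxE; ring.
have crN y : cr (- y) = - cr y by rewrite /cr !mxE; ring.
have sum0 (t : R) : - t = t -> t = 0 by move=> h; lra.
have alt y z : y = p /\ z = q \/ y = q /\ z = p -> dot p p = dot q q \/ cr y = 0 \/ dt y = 0.
  move=> yz.
  have [j] : exists j, reflection u *m y = pt x j by case: yz => [[-> _]|[-> _]]; apply: x_refl.
  have same y' : reflection u *m y = y' -> dot y' y' = dot y y.
    by move=> <-; rewrite !dotdc dtr crr; ring.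
  have fix1 y' : reflection u *m y = y' -> y' = y -> cr y = 0.
    by move=> <- e; apply: sum0; rewrite -crr e.
  have fix2 y' : reflection u *m y = y' -> y' = - y -> dt y = 0.
    by move=> <- e; apply: sum0; rewrite -dtN -e dtr.
  move: j; apply: (ptP (fun y' => reflection u *m y = y' -> _)) => e;
  case: yz => -[ey ez]; subst y z.
  - by right; left; apply: (fix1 _ e).
  - by left; apply: same e.
  - by right; right; apply: (fix2 _ e).
  - by left; rewrite -(same _ e) dotNN.
  - by left; rewrite (same _ e).
  - by right; left; apply: (fix1 _ e).
  - by left; rewrite -(same _ e) dotNN.
  - by right; right; apply: (fix2 _ e).
have i01 : 0 + 1 = 1 :> 'I_4 by apply: val_inj.
have i12 : 1 + 1 = 2 :> 'I_4 by apply: val_inj.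
have i23 : 2 + 1 = 3 :> 'I_4 by apply: val_inj.
have i30 : 3 + 1 = 0 :> 'I_4 by apply: val_inj.
(* The scalar product of consecutive sides is [|p|^2 - |q|^2] up to sign. *)
have rectangle : dot p p = dot q q -> rectangle_vertices x.
  rewrite !dotE => pq; exists s.
  by apply: ord4P; rewrite ?i01 ?i12 ?i23 ?i30 ?i01 ?i12 ?p2 ?q3 -/p -/q;
    rewrite !dotE !mxE -!ptE -/p -/q; lra.
(* The squared side lengths are [|p|^2 + |q|^2] plus or minus twice [dot p q]. *)
have rhombus : dot p q = 0 -> rhombus_vertices x.
  rewrite !dotE => pq; exists s.
  apply: ord4P; rewrite ?i01 ?i12 ?i23 ?i30 ?p2 ?q3 -/p -/q //; congr (Num.sqrt _);
    by rewrite !dotE !mxE -!ptE -/p -/q; lra.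
have unit_dir (z : 'cV[R]_2) : dot z z = 1 -> z != 0.
  move=> z1; apply: contra_eq_neq z1 => ->; rewrite dotE !mxE; apply/eqP; lra.
have along y : cr y = 0 -> exists t, y = 0 + t *: u.
  rewrite /cr => cy; exists (dt y); rewrite add0r; apply/matrixP => k l; rewrite ord1 mxE.
  elim/ord2P: k; rewrite -/a -/b /dt.
    by transitivity ((a * a + b * b) * y 0 0 + b * (a * y 1 0 - b * y 0 0));
      [rewrite ab1 cy|]; ring.
  by transitivity ((a * a + b * b) * y 1 0 - a * (a * y 1 0 - b * y 0 0));
      [rewrite ab1 cy|]; ring.
pose u' : 'cV[R]_2 := mx22 0 (- 1) 1 0 *m u.
have u'E : (u' 0 0 = - b) * (u' 1 0 = a).
  by rewrite !mxE !sum_ord2 !mxE /=; split; rewrite -/a -/b; ring.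
have across y : dt y = 0 -> exists t, y = 0 + t *: u'.
  rewrite /dt => cy; exists (cr y); rewrite add0r; apply/matrixP => k l; rewrite ord1 [RHS]mxE.
  elim/ord2P: k; rewrite !u'E /cr.
    by transitivity ((a * a + b * b) * y 0 0 - a * (a * y 0 0 + b * y 1 0));
      [rewrite ab1 cy|]; ring.
  by transitivity ((a * a + b * b) * y 1 0 - b * (a * y 0 0 + b * y 1 0));
      [rewrite ab1 cy|]; ring.
have u0 : u != 0 by apply: unit_dir; rewrite dotE.
have u'0 : u' != 0 by apply: unit_dir; rewrite dotE !u'E; lra.
have [pq|p0] := alt p q (or_introl (conj erefl erefl)); first by right; right; exact: rectangle.
have [pq|q0] := alt q p (or_intror (conj erefl erefl)); first by right; right; exact: rectangle.
(* On a common axis the points are collinear; on different axes the diagonals are orthogonal. *)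
case: p0 q0 => p0 [] q0.
- left; exists 0, u; split=> //; apply: (ptP (fun y => exists t, y = 0 + t *: u));
    apply: along => //; rewrite crN ?p0 ?q0 oppr0 //.
- by right; left; apply: rhombus; rewrite dotdc p0 q0; ring.
- by right; left; apply: rhombus; rewrite dotdc p0 q0; ring.
- left; exists 0, u'; split=> //; apply: (ptP (fun y => exists t, y = 0 + t *: u'));
    apply: across => //; rewrite dtN ?p0 ?q0 oppr0 //.
Qed.

End Trichotomy.

(** * The factorization for a general pair potential *)

Section Core.
Variable R : realType.
Implicit Types (m : 'I_4 -> R) (x : 'cV[R]_8) (u : 'cV[R]_2).

(** A label fixed by [rho] carries the origin, and distinct points allow only one such label. *)
Lemma central_involution u x : injective (pt x) -> D2_symmetric u x ->
  exists rho : 'I_4 -> 'I_4, [/\ involutive rho, forall i, pt x (rho i) = - pt x i &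
    forall i j, rho i = i -> rho j = j -> i = j].
Proof.
move=> x_inj x_sym.
have /choice[rho rhoP] : forall i, exists j, - 1%:M *m pt x i = pt x j.
  by apply: x_sym; rewrite !inE eqxx orbT.
have xrho i : pt x (rho i) = - pt x i by rewrite -rhoP mulNmx mul1mx.
exists rho; split=> //; first exact: rhoK x_inj xrho.
have z k : rho k = k -> pt x k = 0.
  move=> rk; apply/matrixP => p q; have := xrho k; rewrite rk.
  by move=> /(congr1 (fun y : 'cV_2 => y p q)); rewrite !mxE => ?; lra.
by move=> i j /z zi /z zj; apply: x_inj; rewrite zi zj.
Qed.

Lemma D2_symmetric_trichotomy u x : enorm u = 1 -> injective (pt x) -> D2_symmetric u x ->
  collinear_points x \/ rhombus_vertices x \/ rectangle_vertices x.
Proof.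
move=> u1 x_inj x_sym.
have [rho [rK xrho rfix]] := central_involution x_inj x_sym.
have [s [s2 s3]] := central_labels rK rfix.
apply: (central_trichotomy (u := u) (s := s)) => //; rewrite ?s2 ?s3 ?xrho //.
by move=> i; apply: x_sym; rewrite !inE eqxx ?orbT /= ?orbT.
Qed.

(** Common form of both problems: [gamma] is the degree of homogeneity of [phi], and [c] stands for
    [omega ^+ 2] or [- omega]. *)
Lemma equilibrium_factorization (Phi phi chi : R -> R) (gamma c : R) u m x :
  injective (pt x) -> D2_symmetric u x -> (forall i, m i != 0) ->
  D2_symmetric_masses u x m ->
  (forall s : R, 0 < s -> is_derive s 1 Phi (phi s)) ->
  (forall s : R, 0 < s -> is_derive s 1 phi (chi s)) ->
  (forall s : R, 0 < s -> chi s * s = gamma * phi s) ->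
  grad (pair_potential Phi m) x = c *: (massmx m *m x) ->
  let A := invmx (massmx m) *m Dgrad (pair_potential Phi m) x in
  exists a b : 'I_4 -> R,
  (forall c y : {poly R}, \det (map_mx polyC A + c%:M + y *: Jmx) =
    \prod_i \det (skew_block ((a i)%:P + c) ((b i)%:P + c) y)) /\
  (total_mass m != 0 ->
   (forall s : R, 0 < s -> phi s = 2^-1 /\ chi s = 0) \/ inertia m x != 0 ->
   exists v : 'I_4 -> 'cV[R]_8, splits_A A m a b v).
Proof.
move=> x_inj x_sym m0 m_sym dPhi dphi homog equil.
have xs : pairwise_separated x.
  move=> i j ij; rewrite lt_neqAle dotE -!expr2 addr_ge0 ?sqr_ge0 // andbT eq_sym.
  rewrite paddr_eq0 ?sqr_ge0 // !sqrf_eq0; apply: contra ij => /andP[/eqP e0 /eqP e1].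
  apply/eqP/x_inj/matrixP => k l; rewrite ord1; apply/eqP; rewrite -subr_eq0.
  by move: e0 e1; rewrite !difE -!ptE => e0 e1; elim/ord2P: k; apply/eqP.
have [rho [rK xrho rfix]] := central_involution x_inj x_sym.
have mrho i : m (rho i) = m i.
  by apply: (m_sym (- 1%:M)); rewrite ?inE ?eqxx /= ?orbT // mulNmx mul1mx xrho.
have [s [s2 s3]] := central_labels rK rfix.
have si (j k : 'I_4) : (s j == s k) = (j == k) by rewrite (inj_eq perm_inj).
have DE := Dgrad_pair_potential dPhi dphi m _ _ xs.
(* Pairing with an arbitrary [w] turns the equilibrium equation into an identity of linear forms. *)
have eq w : pair_grad phi m x w = c * Minner m w x.
  by rewrite -(grad_pair_potential dPhi) // equil -scalemxAr mxE mulmxA.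
have Dx w : bil (Dgrad (pair_potential Phi m) x) x w = (1 + 2 * gamma) * c * Minner m x w.
  by rewrite DE; exact: pair_hess_radial xs homog eq w.
have DJx w : bil (Dgrad (pair_potential Phi m) x) (Jmx *m x) w = c * Minner m (Jmx *m x) w.
  by rewrite DE; exact: pair_hess_rotation eq w.
have sum4 (f : 'I_4 -> R) : \sum_i f i = f (s 0) + f (rho (s 0)) + f (s 1) + f (rho (s 1)).
  by rewrite (sum_perm4 s) -s2 -s3; ring.
have all4 (P : 'I_4 -> Prop) : P (s 0) -> P (rho (s 0)) -> P (s 1) -> P (rho (s 1)) ->
    forall i, P i.
  by rewrite -s2 -s3 => *; apply: (perm4P (s := s)).
have e1 : (rho (s 0) == s 0) = false by rewrite -s2 si.
have e2 : (rho (s 1) == s 1) = false by rewrite -s3 si.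
have e3 : (s 1 == s 0) = false by rewrite si.
have e4 : (s 1 == rho (s 0)) = false by rewrite -s2 si.
have e5 : (rho (s 1) == s 0) = false by rewrite -s3 si.
have e6 : (rho (s 1) == rho (s 0)) = false by rewrite -s2 -s3 si.
have [a [b [h1 h2]]] := central_factorization m0 x_inj xrho mrho sum4 all4
  e1 e2 e3 e4 e5 e6 DE Dx DJx.
exists a, b; split=> // tm fl; apply: h2 => //; case: fl => [fl|]; [left|by right].
exists (total_mass m); apply: (flat_form mrho sum4 DE xs) => t t0;
  by case: (fl t t0).
Qed.

End Core.

(** * The power-law and logarithmic potentials *)

Section Potentials.
Variable R : realType.
Implicit Types (m : 'I_4 -> R) (x : 'cV[R]_8).

Lemma dot_ge0 (y : 'cV[R]_2) : 0 <= dot y y.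
Proof. by rewrite dotE -!expr2 addr_ge0 ?sqr_ge0. Qed.

Lemma U_bodyE (gamma : R) m :
  U_body gamma m = pair_potential (fun s => (2 * gamma + 2)^-1 * s `^ (gamma + 1)) m.
Proof.
apply/funext => x; rewrite /U_body mulr_sumr; apply: eq_bigr => i _.
rewrite mulr_sumr; apply: eq_bigr => j _.
rewrite mulrCA; congr (_ * (_ * _)).
rewrite /enorm -powR12_sqrt ?dot_ge0 // -powRrM; congr (_ `^ _).
by field.
Qed.

Lemma H_vortexE m : H_vortex m = pair_potential (fun s => - 2^-1 * ln s) m.
Proof.
apply/funext => x; rewrite /H_vortex -sumrN; apply: eq_bigr => i _.
rewrite -sumrN; apply: eq_bigr => j _.
rewrite mulNr mulrN; congr (- (_ * _)).
rewrite /enorm; have [s0|] := ltP 0 (dot (pt x i - pt x j) (pt x i - pt x j)).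
  by rewrite -powR12_sqrt ?ltW // ln_powR.
(* At a collision both logarithms take their default value 0, so the two functions agree
   everywhere. *)
by move=> s0; rewrite !ln0 ?mulr0 // -sqrtr0; rewrite ler_sqrt.
Qed.

Lemma is_derive_U_pair (gamma s : R) : gamma != -1 -> 0 < s ->
  is_derive s 1 (fun s => (2 * gamma + 2)^-1 * s `^ (gamma + 1)) (2^-1 * s `^ gamma).
Proof.
move=> g1 s0; apply: (is_derive_eq (is_deriveZ _ (is_derive1_powR (gamma + 1) s0))).
rewrite addrK /GRing.scale /=; field.
by apply: contra_neq g1 => h; lra.
Qed.

Lemma is_derive_U_pair_deriv (gamma s : R) : 0 < s ->
  is_derive s 1 (fun s => 2^-1 * s `^ gamma) (2^-1 * (gamma * s `^ (gamma - 1))).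
Proof. by move=> s0; apply: is_deriveZ; apply: is_derive1_powR. Qed.

Lemma is_derive_H_pair (s : R) : 0 < s ->
  is_derive s 1 (fun s => - 2^-1 * ln s) (- 2^-1 * s^-1).
Proof. by move=> s0; apply: is_deriveZ; apply: is_derive1_ln. Qed.

Lemma is_derive_H_pair_deriv (s : R) : 0 < s ->
  is_derive s 1 (fun s => - 2^-1 * s^-1) (2^-1 * s ^- 2).
Proof.
move=> s0; have := is_deriveZ (- 2^-1) (is_deriveV (lt0r_neq0 s0) (is_derive_id s 1)).
move=> H; apply: (is_derive_eq H); rewrite /GRing.scale /=.
by ring.
Qed.

Lemma U_pair_homogeneous (gamma s : R) : 0 < s ->
  2^-1 * (gamma * s `^ (gamma - 1)) * s = gamma * (2^-1 * s `^ gamma).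
Proof.
move=> s0; rewrite powRB ?(gt_eqF s0) ?implybT // powRr1 ?ltW //.
by field; rewrite gt_eqF.
Qed.

Lemma H_pair_homogeneous (s : R) : 0 < s ->
  2^-1 * s ^- 2 * s = -1 * (- 2^-1 * s^-1).
Proof. by move=> s0; field; rewrite gt_eqF. Qed.

End Potentials.

(** * Degrees of the 2 by 2 determinants *)

Section Blocks.
Variable R : realType.

Lemma det_skew_block (S : comNzRingType) (a b c : S) :
  \det (skew_block a b c) = a * b + c ^+ 2.
Proof.
rewrite (expand_det_row _ 0) sum_ord2 /cofactor !det_mx11 !mxE /=.
by rewrite expr0 expr1; ring.
Qed.

Lemma size_quadratic (b c : R) : size ('X^2 + b *: 'X + c%:P : {poly R}) = 3%N.
Proof.
rewrite -addrA size_polyDl size_polyXn //.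
rewrite (leq_ltn_trans (size_polyD _ _)) // gtn_max.
rewrite (leq_ltn_trans (size_scale_leq _ _)) ?size_polyX //.
by rewrite (leq_ltn_trans (size_polyC_leq1 _)).
Qed.

(** In [Y = 'X^2] the determinant is [(a + Y - omega^2) (b + Y - omega^2) + 4 omega^2 Y]; its
    expansion gives the coefficients of [q]. *)
Lemma det_body_block (omega a b : R) : exists2 q : {poly R}, size q = 3%N &
  \det (body_block omega a b) = q \Po 'X^2.
Proof.
exists ('X^2 + (a + b + 2 * omega ^+ 2) *: 'X + ((a - omega ^+ 2) * (b - omega ^+ 2))%:P).
  exact: size_quadratic.
rewrite det_skew_block !comp_polyD comp_polyZ comp_polyC comp_polyX comp_Xn_poly.
rewrite -mul_polyC; rewrite !(polyCD, polyCM, polyCN, polyC_exp, polyC1) /=.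
ring.
Qed.

Lemma size_vortex_block (omega a b : R) : size (\det (vortex_block omega a b)) = 3%N.
Proof.
rewrite det_skew_block -!polyCD -polyCM -(size_quadratic 0 ((a + omega) * (b + omega))).
by rewrite scale0r addr0 addrC.
Qed.

End Blocks.

Theorem mainTheorem4 (R : realType) (omega : R) (u : 'cV[R]_2)
    (m : 'I_4 -> R) (x : 'cV[R]_8)
    (omega_neq0 : omega != 0)
    (u_unit : enorm u = 1)
    (x_distinct : injective (pt x))
    (x_sym : D2_symmetric u x)
    (m_neq0 : forall i, m i != 0)
    (m_sym : D2_symmetric_masses u x m) :
  [/\ collinear_points x \/ rhombus_vertices x \/ rectangle_vertices x,
      forall gamma : R, gamma != -1 -> body_rel_eq gamma omega m x ->
        exists a b : 'I_4 -> R,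
        [/\ forall i, is_eigenvalue (A_body gamma m x) (a i) /\
                      is_eigenvalue (A_body gamma m x) (b i),
            total_mass m != 0 -> (gamma = 0 \/ inertia m x != 0) ->
              exists v : 'I_4 -> 'cV[R]_8, splits_A (A_body gamma m x) m a b v,
            P_body gamma omega m x =
              \prod_(i < 4) \det (body_block omega (a i) (b i)) &
            forall i, exists2 q : {poly R}, size q = 3%N &
              \det (body_block omega (a i) (b i)) = q \Po 'X^2] &
      vortex_rel_eq omega m x ->
        exists a b : 'I_4 -> R,
        [/\ forall i, is_eigenvalue (A_vortex m x) (a i) /\
                      is_eigenvalue (A_vortex m x) (b i),
            total_mass m != 0 -> inertia m x != 0 ->
              exists v : 'I_4 -> 'cV[R]_8, splits_A (A_vortex m x) m a b v,
            P_vortex omega m x =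
              \prod_(i < 4) \det (vortex_block omega (a i) (b i)) &
            forall i, size (\det (vortex_block omega (a i) (b i))) = 3%N]].
Proof.
split; first exact: D2_symmetric_trichotomy u_unit x_distinct x_sym.
- move=> gamma g1; rewrite /body_rel_eq /A_body /P_body /A_body U_bodyE => equil.
  have [a [b [detA splitA]]] := equilibrium_factorization x_distinct x_sym m_neq0 m_sym
    (fun s => @is_derive_U_pair R gamma s g1) (@is_derive_U_pair_deriv R gamma)
    (U_pair_homogeneous gamma) equil.
  exists a, b; split.
  + by move=> i; apply: det_pencil_eigenvalue detA.
  + move=> tm [g0|I0]; apply: splitA => //; last by right.
    (* For [gamma = 0] the power is 1, so [phi] is constant and [chi] vanishes. *)
    by left=> s s0; rewrite g0 powRr0 mulr1 mul0r mulr0.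
  + exact: detA.
  + by move=> i; apply: det_body_block.
- rewrite /vortex_rel_eq /A_vortex /P_vortex /A_vortex H_vortexE => equil.
  (* Here [phi] is [- 1 / (2 s)], homogeneous of degree -1. *)
  have [a [b [detA splitA]]] := equilibrium_factorization x_distinct x_sym m_neq0 m_sym
    (@is_derive_H_pair R) (@is_derive_H_pair_deriv R) (@H_pair_homogeneous R) equil.
  exists a, b; split.
  + by move=> i; apply: det_pencil_eigenvalue detA.
  + by move=> tm I0; apply: splitA => //; right.
  + exact: detA.
  + by move=> i; apply: size_vortex_block.
Qed.
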